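(* Let $(\mathbf{L},\sigma)$ be an object of the category $\mathcal{B}$. The quantum algebra $U_q(\mathbf{L})$ is the universal enveloping algebra of the Poisson–Lie algebra of functions on the dual group $\exp(\mathbf{L}^* )$, in the following sense: regard $H_i$ and $X^\mu$ as coordinate functions on the group $\exp(\mathbf{L}^* )=\mathbf{H}^*\triangleleft\exp(\mathbf{V}^* )$ for which the group multiplication is $$\Delta(X^\mu)=D^\mu(X\otimes 1,1\otimes X),\qquad \Delta(H_i)=(e^{\alpha\cdot X})^k_i\otimes H_k+H_i\otimes 1,$$ and let $\{\cdot,\cdot\}$ be the Poisson–Lie bracket on $\exp(\mathbf{L}^* )$ whose linearization at the identity is the Lie bracket of $\mathbf{L}$. Then the commutation relations of the generators of $U_q(\mathbf{L})$ coincide with the Poisson brackets of these coordinate functions: $$\{X^\mu,X^\nu\}=0,\qquad \{H_i,H_k\}=C(X)^m_{ik}H_m,\qquad \{H_i,X^\mu\}=A(X)_i^\mu,$$ where $C(X)^m_{ik}$ and $A(X)_i^\mu$ are the formal power series occurring in the defining relations $[X^\mu,X^\nu]=0$, $[H_i,H_k]=C(X)^m_{ik}H_m$, $[H_i,X^\mu]=A(X)_i^\mu$ of $U_q(\mathbf{L})$.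
   Context: Everything is over a ground field $K$ ($\mathbb{R}$ or $\mathbb{C}$), Lie bialgebras are finite-dimensional, and repeated indices are summed. Category $\mathcal{B}$. An object is a Lie bialgebra $\mathbf{L}$ with cobracket $\delta$ and a linear involution $\sigma$ of $\mathbf{L}$ that is an anti-automorphism of the Lie algebra and an automorphism of the Lie coalgebra, such that the $\sigma$-invariant subspace $\mathbf{V}\subset\mathbf{L}$ and the $(-\sigma^* )$-invariant subspace of $\mathbf{L}^*$ are Lie subalgebras (hence commutative). Let $\mathbf{H}$ be the $(-1)$-eigenspace of $\sigma$. In bases $H_i$ of $\mathbf{H}$ and $X^\mu$ of $\mathbf{V}$ this means $$[H_i,H_k]=C^m_{ik}H_m,\quad [H_i,X^\mu]=A_{i\nu}^{\;\mu}X^\nu,\quad [X^\mu,X^\nu]=0,$$ $$\delta(X^\mu)=\gamma^\mu_{\rho\sigma}X^\rho\otimes X^\sigma,\quad \delta(H_i)=\alpha_{\rho i}^{\;k}(X^\rho\otimes H_k-H_k\otimes X^\rho).$$ Quantization. $(\alpha\cdot X)^k_i=\alpha_{\rho i}^{\;k}X^\rho$, and $D$ is the Campbell–Hausdorff series of the Lie algebra $\mathbf{V}^*$ with structure constants $\gamma^\mu_{\rho\sigma}$. For $\mathbf{L}$ in $\mathcal{B}$, $U_q(\mathbf{L})$ is the unique Hopf algebra generated by $K[[X^\mu]]$ and the $H_i$, equal to $K[[X^\mu]]\otimes U(\mathbf{H})$ as a linear space, with coproduct (in the tensor product completed in the $X$-variables) $$\Delta(X^\mu)=D^\mu(X\otimes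 1,1\otimes X),\qquad \Delta(H_i)=(e^{\alpha\cdot X})^k_i\otimes H_k+H_i\otimes 1,$$ and relations $[X^\mu,X^\nu]=0$, $[H_i,H_k]=C(X)^m_{ik}H_m$, $[H_i,X^\mu]=A(X)_i^\mu$ with formal power series $C(X),A(X)$ satisfying $C(0)^m_{ik}=C^m_{ik}$ and $\partial A(0)_i^\mu/\partial X^\nu=A_{i\nu}^{\;\mu}$. Its counit vanishes on $H_i$ and $X^\mu$. Dual group. $\exp(\mathbf{L}^* )$ is the (local or formal) Lie group of the Lie algebra $\mathbf{L}^*$, whose bracket is dual to $\delta$. The $X^\mu$ are the logarithmic coordinates on the subgroup $\exp(\mathbf{V}^* )$ and the $H_i$ are linear coordinates on the abelian normal subgroup $\mathbf{H}^*$; $\Delta$ on functions is the pull-back along the group multiplication. A Poisson–Lie bracket is a Poisson bracket on functions for which $\Delta$ is a Poisson map; it vanishes at the identity, and its linearization there is a Lie bracket on the cotangent space $(\mathbf{L}^* )^*=\mathbf{L}$. *)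

(* Defs.v *)
From HB Require Import structures.
From mathcomp Require Import all_boot all_order all_algebra.
From mathcomp Require Import boolp.

Set Implicit Arguments.
Unset Strict Implicit.
Unset Printing Implicit Defensive.

Import Order.TTheory GRing.Theory Num.Theory.
Local Open Scope ring_scope.

Section Exponents.
Variable I : finType.

(* Exponents of monomials in variables indexed by I, with pointwise sum. *)
Definition expo := {ffun I -> nat}.

Definition edeg (d : expo) : nat := (\sum_i d i)%N.

Definition evar (i : I) : expo := [ffun j => (j == i) : nat].

Definition ebox (N : nat) := {ffun I -> 'I_N.+1}.

Definition ebv (N : nat) (a : ebox N) : expo := [ffun i => nat_of_ord (a i)].

Lemma ebv_inj N : injective (@ebv N).
Proof.
move=> a b /ffunP ab; apply/ffunP => i; apply/val_inj.
by have := ab i; rewrite !ffunE.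
Qed.

Lemma ebv_ex N (d : expo) : (forall i, d i <= N)%N -> exists a, @ebv N a = d.
Proof.
move=> dN; exists [ffun i => inord (d i)].
by apply/ffunP => i; rewrite !ffunE inordK // ltnS.
Qed.

Lemma leq_edeg (d : expo) i : (d i <= edeg d)%N.
Proof. by rewrite /edeg (bigD1 i) //= leq_addr. Qed.

Lemma expoDE (a b : expo) i : (a + b) i = (a i + b i)%N.
Proof. by rewrite ffunE. Qed.

End Exponents.

Section SumBox.
Variables (I : finType) (V : nmodType).

Lemma sum_ebv1 N (d : expo I) (F : expo I -> V) : (forall i, d i <= N)%N ->
  \sum_(a : ebox I N | ebv a == d) F (ebv a) = F d.
Proof.
move=> /ebv_ex [a <-]; rewrite (big_pred1 a) // => b /=.
by rewrite (inj_eq (@ebv_inj _ _)).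
Qed.

Lemma sum_ebv_indep N M (P : pred (expo I)) (F : expo I -> V) :
  (forall d, P d -> forall i, (d i <= N)%N) ->
  (forall d, P d -> forall i, (d i <= M)%N) ->
  \sum_(a : ebox I N | P (ebv a)) F (ebv a) =
  \sum_(a : ebox I M | P (ebv a)) F (ebv a).
Proof.
move=> PN PM.
have h (A B : nat) (a : ebox I A) : (forall i, ebv a i <= B)%N ->
    ebv ([ffun i => inord (a i)] : ebox I B) = ebv a.
  move=> ab; apply/ffunP => i; rewrite !ffunE inordK // ltnS.
  by have := ab i; rewrite ffunE.
pose up (a : ebox I M) : ebox I N := [ffun i => inord (a i)].
pose dn (a : ebox I N) : ebox I M := [ffun i => inord (a i)].
have upE a : P (ebv a) -> ebv (up a) = ebv a by move=> Pa; apply: h; apply: PN.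
have dnE a : P (ebv a) -> ebv (dn a) = ebv a by move=> Pa; apply: h; apply: PM.
rewrite (reindex_onto up dn) /=; last first.
  by move=> a Pa; apply/ebv_inj; rewrite upE dnE.
have E a : P (ebv (up a)) && (dn (up a) == a) = P (ebv a).
  apply/andP/idP => [[Pa /eqP aE]|Pa]; first by rewrite -aE dnE.
  rewrite upE //; split => //; apply/eqP/ebv_inj.
  by rewrite dnE upE.
by apply: eq_big => // a; rewrite E => Pa; rewrite upE.
Qed.

End SumBox.

Definition fps (K : Type) (I : finType) := expo I -> K.

HB.instance Definition _ (K : Type) (I : finType) := gen_eqMixin (fps K I).
HB.instance Definition _ (K : Type) (I : finType) := gen_choiceMixin (fps K I).

Section FpsRing.
Variables (K : comNzRingType) (I : finType).
Implicit Types f g h : fps K I.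

Lemma fpsP f g : (forall d, f d = g d) <-> f = g.
Proof. by split => [/funext //|->]. Qed.

Definition fps_zero : fps K I := fun=> 0.
Definition fps_opp f : fps K I := fun d => - f d.
Definition fps_add f g : fps K I := fun d => f d + g d.

Let addA : associative fps_add.
Proof. by move=> f g h; apply/fpsP => d; rewrite /fps_add addrA. Qed.
Let addC : commutative fps_add.
Proof. by move=> f g; apply/fpsP => d; rewrite /fps_add addrC. Qed.
Let add0 : left_id fps_zero fps_add.
Proof. by move=> f; apply/fpsP => d; rewrite /fps_add add0r. Qed.
Let addN : left_inverse fps_zero fps_opp fps_add.
Proof. by move=> f; apply/fpsP => d; rewrite /fps_add addNr. Qed.

HB.instance Definition _ := GRing.isZmodule.Build (fps K I) addA addC add0 addN.

Lemma fpsDE f g d : (f + g) d = f d + g d. Proof. by []. Qed.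
Lemma fpsNE f d : (- f) d = - f d. Proof. by []. Qed.
Lemma fps0E d : (0 : fps K I) d = 0. Proof. by []. Qed.
Lemma fps_sumE (J : Type) (r : seq J) (P : pred J) (F : J -> fps K I) d :
  (\sum_(j <- r | P j) F j) d = \sum_(j <- r | P j) F j d.
Proof. by elim/big_rec2: _ => // j x y _ <-. Qed.

Definition fps_one : fps K I := fun d => (d == 0)%:R.

(* Cauchy product: every exponent below d lies in ebox I (edeg d). *)
Definition fps_mul f g : fps K I := fun d =>
  \sum_(a : ebox I (edeg d)) \sum_(b : ebox I (edeg d) | ebv a + ebv b == d)
    f (ebv a) * g (ebv b).

Lemma fps_mulN N f g (d : expo I) : (forall i, d i <= N)%N ->
  fps_mul f g d =
  \sum_(a : ebox I N) \sum_(b : ebox I N | ebv a + ebv b == d)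
    f (ebv a) * g (ebv b).
Proof.
move=> dN; rewrite /fps_mul.
have le1 (a b : expo I) i : a + b == d -> (a i <= d i)%N.
  by move/eqP <-; rewrite expoDE leq_addr.
have le2 (a b : expo I) i : a + b == d -> (b i <= d i)%N.
  by move/eqP <-; rewrite expoDE leq_addl.
pose F (a : expo I) := \sum_(b : ebox I N | a + ebv b == d) f a * g (ebv b).
have FE M (a : expo I) : (forall i, d i <= M)%N ->
    \sum_(b : ebox I M | a + ebv b == d) f a * g (ebv b) = F a.
  move=> dM; apply: (@sum_ebv_indep _ _ M N (fun b => a + b == d)
    (fun b => f a * g b)) => b /le2 h i;
  by apply: leq_trans (h i) _.
under eq_bigr do rewrite (FE _ _ (leq_edeg d)).
rewrite [RHS](_ : _ = \sum_(a : ebox I N) F (ebv a)) //.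
pose P (a : expo I) := [forall i, (a i <= d i)%N].
have F0 a : ~~ P a -> F a = 0.
  move=> Pa; rewrite /F big1 // => b ab; case/negP: Pa.
  by apply/forallP => i; apply: le1 ab.
rewrite [LHS](bigID (fun a : ebox I _ => P (ebv a))) /=.
rewrite [X in _ + X]big1 ?addr0; last by move=> a; apply: F0.
rewrite [RHS](bigID (fun a : ebox I _ => P (ebv a))) /=.
rewrite [X in _ = _ + X]big1 ?addr0; last by move=> a; apply: F0.
apply: sum_ebv_indep => a /forallP ad i; apply: leq_trans (ad i) _ => //.
exact: leq_edeg.
Qed.

Lemma fps_mulC : commutative fps_mul.
Proof.
move=> f g; apply/fpsP => d; rewrite /fps_mul (exchange_big_dep xpredT) //=.
apply: eq_bigr => a _; apply: eq_big => [b|b _]; first by rewrite addrC.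
by rewrite mulrC.
Qed.

Lemma fps_mul1 : left_id fps_one fps_mul.
Proof.
move=> f; apply/fpsP => d; rewrite /fps_mul.
have [a0 a0E] : exists a0, @ebv I (edeg d) a0 = 0.
  by apply: ebv_ex => i; rewrite ffunE.
rewrite (bigD1 a0) //= [X in _ + X]big1 ?addr0; last first.
  move=> a aa0; rewrite big1 // => b _; rewrite /fps_one.
  by rewrite -a0E (inj_eq (@ebv_inj _ _)) (negbTE aa0) mul0r.
rewrite a0E (eq_bigl (fun b : ebox I (edeg d) => ebv b == d)); last first.
  by move=> b; rewrite add0r.
rewrite (sum_ebv1 (fun b => fps_one 0 * f b)); last exact: leq_edeg.
by rewrite /fps_one eqxx mul1r.
Qed.

Lemma fps_mulA : associative fps_mul.
Proof.
suff H f g h (d : expo I) : fps_mul (fps_mul f g) h d =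
    \sum_(x : ebox I (edeg d)) \sum_(y : ebox I (edeg d))
    \sum_(z : ebox I (edeg d) | ebv x + ebv y + ebv z == d)
      f (ebv x) * g (ebv y) * h (ebv z).
  move=> f g h; apply/fpsP => d; rewrite fps_mulC !H.
  rewrite [RHS]exchange_big /=.
  under [RHS]eq_bigr => y _.
    under eq_bigr => x _ do rewrite big_mkcond /=.
    rewrite exchange_big /=; over.
  apply: eq_bigr => y _; apply: eq_bigr => z _.
  rewrite big_mkcond; apply: eq_bigr => x _ /=.
  rewrite (_ : ebv y + ebv z + ebv x = ebv x + ebv y + ebv z); last first.
    by rewrite addrC addrA.
  by case: ifP => // _; rewrite mulrC mulrA.
rewrite {1}/fps_mul.
set N := edeg d.
transitivity (\sum_(a : ebox I N) \sum_(c : ebox I N | ebv a + ebv c == d)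
   \sum_(x : ebox I N) \sum_(y : ebox I N | ebv x + ebv y == ebv a)
     f (ebv x) * g (ebv y) * h (ebv c)).
  apply: eq_bigr => a _; apply: eq_bigr => c _.
  rewrite (@fps_mulN N) ?mulr_suml; last by move=> i; rewrite ffunE -ltnS.
  by apply: eq_bigr => x _; rewrite mulr_suml.
under eq_bigr => a _ do rewrite exchange_big /=.
rewrite exchange_big /=; apply: eq_bigr => x _.
under eq_bigr => a _.
  under eq_bigr => c _ do rewrite big_mkcond /=.
  rewrite exchange_big /=; over.
rewrite exchange_big /=; apply: eq_bigr => y _.
rewrite (exchange_big_dep xpredT) //= [RHS]big_mkcond /=.
apply: eq_bigr => c _.
rewrite -big_mkcondr /=; case: ifP => [/eqP E|/eqP E].
  have xyN i : ((ebv x + ebv y)%R i <= N)%N.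
    rewrite (leq_trans _ (leq_edeg d i)) // -E [X in (_ <= X)%N]expoDE.
    exact: leq_addr.
  rewrite -[RHS](@sum_ebv1 _ _ N (ebv x + ebv y)
    (fun=> f (ebv x) * g (ebv y) * h (ebv c)) xyN).
  apply: eq_bigl => a /=; rewrite [RHS]eq_sym; apply/andP/eqP => [[_ /eqP//]|E'].
  by rewrite -E' E.
rewrite big1 // => a /andP[/eqP E1 /eqP E2]; case: E.
by rewrite E2.
Qed.

Let mulDl : left_distributive fps_mul +%R.
Proof.
move=> f g h; apply/fpsP => d; rewrite fpsDE /fps_mul -big_split /=.
by apply: eq_bigr => a _; rewrite -big_split /=; apply: eq_bigr => b _; rewrite mulrDl.
Qed.

Let one_neq0 : fps_one != 0.
Proof.
apply/eqP => /fpsP /(_ 0); rewrite /fps_one eqxx fps0E => /eqP.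
by rewrite oner_eq0.
Qed.

HB.instance Definition _ := GRing.Zmodule_isComNzRing.Build (fps K I)
  fps_mulA fps_mulC fps_mul1 mulDl one_neq0.

Definition fps_scale (c : K) f : fps K I := fun d => c * f d.

Let scaleA a b f : fps_scale a (fps_scale b f) = fps_scale (a * b) f.
Proof. by apply/fpsP => d; rewrite /fps_scale mulrA. Qed.
Let scale1 : left_id 1 fps_scale.
Proof. by move=> f; apply/fpsP => d; rewrite /fps_scale mul1r. Qed.
Let scaleDr : right_distributive fps_scale +%R.
Proof. by move=> a f g; apply/fpsP => d; rewrite /fps_scale mulrDr. Qed.
Let scaleDl f : {morph fps_scale^~ f : a b / a + b}.
Proof. by move=> a b; apply/fpsP => d; rewrite /fps_scale mulrDl. Qed.

HB.instance Definition _ := GRing.Zmodule_isLmodule.Build K (fps K I)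
  scaleA scale1 scaleDr scaleDl.

Let scaleAl (a : K) (f g : fps K I) : a *: (f * g) = a *: f * g.
Proof.
apply/fpsP => d; change (a * fps_mul f g d = fps_mul (fps_scale a f) g d).
rewrite /fps_mul /fps_scale.
rewrite mulr_sumr; apply: eq_bigr => x _; rewrite mulr_sumr.
by apply: eq_bigr => y _; rewrite mulrA.
Qed.

HB.instance Definition _ := GRing.Lmodule_isLalgebra.Build K (fps K I) scaleAl.
HB.instance Definition _ := GRing.Lalgebra_isComAlgebra.Build K (fps K I).

Definition fvar (i : I) : fps K I := fun d => (d == evar i)%:R.

(* f lies in the k-th power of the maximal ideal. *)
Definition vanishes (k : nat) f := forall d : expo I, (edeg d < k)%N -> f d = 0.

End FpsRing.

(* Substitution f(g), meaningful when all g i have zero constant term: the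
   coefficient of degree edeg d then only involves monomials of f of degree at
   most edeg d, so that the sum below contains all nonzero contributions. *)
Definition fsubst (K : comNzRingType) (I J : finType) (g : I -> fps K J)
    (f : fps K I) : fps K J :=
  fun d => \sum_(a : ebox I (edeg d))
             f (ebv a) * (\prod_i g i ^+ ebv a i : fps K J) d.

Definition fren (K : comNzRingType) (I J : finType) (r : I -> J) :
    fps K I -> fps K J := fsubst (fun i => fvar K (r i)).

(* Exponential of a matrix whose entries have zero constant term: only the
   powers M ^+ p with p <= edeg d contribute to the coefficient d. *)
Definition fexpmx (K : fieldType) (I : finType) (m : nat) (M : 'M[fps K I]_m) :
    'M[fps K I]_m :=
  \matrix_(i, k) (fun d => \sum_(p < (edeg d).+1) (p`!%:R)^-1 * (M ^+ p) i k d).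

Section CampbellHausdorff.
Variable K : fieldType.

(* Noncommutative series in two letters x = false and y = true, as functions
   on words. *)
Definition ncs := seq bool -> K.

Definition ncs_one : ncs := fun w => (w == [::])%:R.
Definition ncs_mul (f g : ncs) : ncs := fun w =>
  \sum_(p < (size w).+1) f (take p w) * g (drop p w).
Definition ncs_exp (b : bool) : ncs := fun w =>
  if all (pred1 b) w then ((size w)`!%:R)^-1 else 0.
(* log f = \sum_(p >= 1) (-1)^(p-1) (f - 1)^p / p, for f with constant term 1 *)
Definition ncs_log (f : ncs) : ncs := fun w =>
  \sum_(1 <= p < (size w).+1) (-1) ^+ p.-1 / p%:R *
    iter p (ncs_mul (fun v => f v - ncs_one v)) ncs_one w.

Definition ch_coef : ncs := ncs_log (ncs_mul (ncs_exp false) (ncs_exp true)).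

(* gam mu rho sig: [e_rho, e_sig] = \sum_mu gam mu rho sig e_mu. *)
Variables (n : nat) (gam : 'I_n -> 'I_n -> 'I_n -> K).

Let S := fps K ('I_n + 'I_n)%type.

Definition ch_br (u v : 'I_n -> S) : 'I_n -> S := fun mu =>
  \sum_rho \sum_sig gam mu rho sig *: (u rho * v sig).

Definition ch_letter (b : bool) : 'I_n -> S := fun mu =>
  fvar K (if b then inr mu else inl mu).

(* Right-nested bracket of a word evaluated at the generic pair of elements. *)
Fixpoint ch_word (w : seq bool) : 'I_n -> S :=
  match w with
  | [::] => fun=> 0
  | [:: b] => ch_letter b
  | b :: w' => ch_br (ch_letter b) (ch_word w')
  end.

(* Components of log(e^x e^y) = \sum_w ch_coef w / |w| [w] (Dynkin, Specht,
   Wever); inl and inr variables are the coordinates of x and y. The bracket of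
   a word of length N is homogeneous of degree N. *)
Definition campbell_hausdorff (mu : 'I_n) : S := fun d =>
  \sum_(w : (edeg d).-tuple bool) ch_coef w / (edeg d)%:R * ch_word w mu d.

End CampbellHausdorff.

Definition lie_bracket (K : fieldType) (W : lmodType K) (br : W -> W -> W) :=
  [/\ forall x, linear (br x),
      forall y, linear (br^~ y),
      forall x, br x x = 0 &
      forall x y z, br x (br y z) + br y (br z x) + br z (br x y) = 0].

Section Tensors.
Variables (K : fieldType) (L : vectType K).

Definition dual := 'Hom(L, K^o).

(* L (x) L, for L of finite dimension: u (x) v is the map phi |-> phi u *: v *)
Definition tensor2 := 'Hom(dual, L).

Definition tens (u v : L) : tensor2 := linfun (fun phi : dual => phi u *: v).

(* (f (x) g) t *)
Definition tmap (f g : 'End(L)) (t : tensor2) : tensor2 :=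
  linfun (fun phi : dual => g (t (phi \o f)%VF)).

(* The bracket dual to a cobracket: x |-> (phi (x) psi) (delta x). *)
Definition dual_bracket (delta : 'Hom(L, tensor2)) (phi psi : dual) : dual :=
  linfun (fun x => psi (delta x phi)).

End Tensors.

Record lieBialgebra (K : fieldType) (L : vectType K) := LieBialgebra {
  lb : 'Hom(L, 'End(L));
  cobr : 'Hom(L, tensor2 L);
  lb_lie : lie_bracket (fun x y => lb x y);
  cobr_lie : lie_bracket (dual_bracket cobr);
  cobr_cocycle : forall x y,
    cobr (lb x y) = tmap (lb x) \1 (cobr y) + tmap \1 (lb x) (cobr y)
                  - (tmap (lb y) \1 (cobr x) + tmap \1 (lb y) (cobr x))
}.

Record catB (K : fieldType) (L : vectType K) := CatB {
  bialg :> lieBialgebra L;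
  sg : 'End(L);
  sg_invol : forall x, sg (sg x) = x;
  sg_anti : forall x y, sg (lb bialg x y) = lb bialg (sg y) (sg x);
  sg_coauto : forall x, cobr bialg (sg x) = tmap sg sg (cobr bialg x);
  sg_inv_sub : forall x y, sg x = x -> sg y = y ->
    sg (lb bialg x y) = lb bialg x y;
  sg_coinv_sub : forall phi psi : dual L,
    - (phi \o sg)%VF = phi -> - (psi \o sg)%VF = psi ->
    - (dual_bracket (cobr bialg) phi psi \o sg)%VF
      = dual_bracket (cobr bialg) phi psi
}.

(* C i k l = C^l_{ik}, A i nu mu = A_{i nu}^mu, gam mu rho sig
   = gamma^mu_{rho sig}, alph rho i k = alpha_{rho i}^k, in bases of the
   (-1)-eigenspace and of the invariant subspace of the involution. *)
Record structure_constants (K : fieldType) (L : vectType K) (B : catB L)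
    (m n : nat) (H : m.-tuple L) (X : n.-tuple L)
    (C : 'I_m -> 'I_m -> 'I_m -> K) (A : 'I_m -> 'I_n -> 'I_n -> K)
    (gam : 'I_n -> 'I_n -> 'I_n -> K) (alph : 'I_n -> 'I_m -> 'I_m -> K) :
    Prop := StructureConstants {
  sc_H : basis_of (passmx.leigenspace (sg B) (-1)) H;
  sc_X : basis_of (fixedSpace (sg B)) X;
  sc_C : forall i k, lb B (tnth H i) (tnth H k) = \sum_l C i k l *: tnth H l;
  sc_A : forall i mu,
    lb B (tnth H i) (tnth X mu) = \sum_nu A i nu mu *: tnth X nu;
  sc_gam : forall mu, cobr B (tnth X mu) =
    \sum_rho \sum_sig gam mu rho sig *: tens (tnth X rho) (tnth X sig);
  sc_alph : forall i, cobr B (tnth H i) =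
    \sum_rho \sum_k alph rho i k *:
      (tens (tnth X rho) (tnth H k) - tens (tnth H k) (tnth X rho))
}.

(* (e^{alpha . X})^k_i in row i and column k; all powers of alpha . X are the
   same in the transposed convention. *)
Definition exp_alpha (K : fieldType) (m n : nat)
    (alph : 'I_n -> 'I_m -> 'I_m -> K) : 'M[fps K 'I_n]_m :=
  fexpmx (\matrix_(i, k) \sum_rho alph rho i k *: fvar K rho).

(* W is a free left module over the power series, on the family b. *)
Definition series_basis (K : fieldType) (I : finType) (W : algType K)
    (E : eqType) (iota : fps K I -> W) (b : E -> W) : Prop :=
  (forall w, exists (s : seq E) (f : E -> fps K I),
     w = \sum_(e <- s) iota (f e) * b e) /\
  (forall (s : seq E) (f : E -> fps K I), uniq s ->
     \sum_(e <- s) iota (f e) * b e = 0 -> forall e, e \in s -> f e = 0).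

(* Fundamental neighbourhoods of 0 in the topology of the series variables. *)
Definition series_nbhs (K : fieldType) (I : finType) (W : algType K)
    (iota : fps K I -> W) (k : nat) (w : W) : Prop :=
  exists2 s : seq (fps K I * W),
    (forall u, u \in s -> vanishes k u.1) & w = \sum_(u <- s) iota u.1 * u.2.

Definition series_continuous (K : fieldType) (I J : finType) (W Z : algType K)
    (iota : fps K I -> W) (iota' : fps K J -> Z) (T : W -> Z) : Prop :=
  forall k, exists l, forall w,
    series_nbhs iota l w -> series_nbhs iota' k (T w).

Definition hmon (K : fieldType) (m : nat) (U : algType K) (h : 'I_m -> U)
    (e : expo 'I_m) : U := \prod_(i < m) h i ^+ e i.

(* The p-th tensor power, completed in the series variables, of an algebra U
   which is the tensor product (of vector spaces) of the series algebra and the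
   span of the ordered monomials in the h i. These requirements determine it up
   to a unique isomorphism. *)
Record completed_power (K : fieldType) (m n : nat) (U : algType K)
    (xi : {lrmorphism fps K 'I_n -> U}) (h : 'I_m -> U) (p : nat) :=
    CompletedPower {
  cp_alg :> algType K;
  cp_ser : {lrmorphism fps K ('I_p * 'I_n)%type -> cp_alg};
  cp_in : 'I_p -> {lrmorphism U -> cp_alg};
  cp_comm : forall a b u v, a != b ->
    cp_in a u * cp_in b v = cp_in b v * cp_in a u;
  cp_inE : forall a f, cp_in a (xi f) = cp_ser (fren (fun mu => (a, mu)) f);
  cp_basis : series_basis cp_ser
    (fun e : {ffun 'I_p -> expo 'I_m} => \prod_(a < p) cp_in a (hmon h (e a)))
}.

(* T is the continuous linear extension to the completed tensor square of the
   map u (x) v |-> beta u v. *)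
Definition tensor_extension (K : fieldType) (m n : nat) (U : algType K)
    (xi : {lrmorphism fps K 'I_n -> U}) (h : 'I_m -> U)
    (W : completed_power xi h 2) (J : finType) (Z : algType K)
    (iota : fps K J -> Z) (beta : U -> U -> Z) (T : {linear W -> Z}) : Prop :=
  (forall u v, T (cp_in W ord0 u * cp_in W ord_max v) = beta u v) /\
  series_continuous (cp_ser W) iota T.

Section QuantumAlgebra.
Variables (K : fieldType) (m n : nat).
Variables (C : 'I_m -> 'I_m -> 'I_m -> K) (A : 'I_m -> 'I_n -> 'I_n -> K).
Variables (gam : 'I_n -> 'I_n -> 'I_n -> K) (alph : 'I_n -> 'I_m -> 'I_m -> K).

Record quantum_algebra := QuantumAlgebra {
  uq :> algType K;
  uq_ser : {lrmorphism fps K 'I_n -> uq};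
  uq_h : 'I_m -> uq;
  (* uq = K[[X]] (x) U(H) as a linear space, by Poincare-Birkhoff-Witt *)
  uq_basis : series_basis uq_ser (hmon uq_h);

  uq_C : 'I_m -> 'I_m -> 'I_m -> fps K 'I_n;
  uq_A : 'I_m -> 'I_n -> fps K 'I_n;
  uq_hh : forall i k, uq_h i * uq_h k - uq_h k * uq_h i =
    \sum_l uq_ser (uq_C i k l) * uq_h l;
  uq_hx : forall i mu,
    uq_h i * uq_ser (fvar K mu) - uq_ser (fvar K mu) * uq_h i =
    uq_ser (uq_A i mu);
  uq_C0 : forall i k l, uq_C i k l 0 = C i k l;
  uq_A1 : forall i mu nu, uq_A i mu (evar nu) = A i nu mu;

  uq2 : completed_power uq_ser uq_h 2;
  uq3 : completed_power uq_ser uq_h 3;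

  uq_Delta : {lrmorphism uq -> uq2};
  uq_DeltaX : forall mu, uq_Delta (uq_ser (fvar K mu)) =
    cp_ser uq2 (fren (fun z => match z with
                               | inl nu => (ord0, nu)
                               | inr nu => (ord_max, nu)
                               end) (campbell_hausdorff gam mu));
  uq_DeltaH : forall i, uq_Delta (uq_h i) =
    \sum_k cp_in uq2 ord0 (uq_ser (exp_alpha alph i k)) *
           cp_in uq2 ord_max (uq_h k)
    + cp_in uq2 ord0 (uq_h i);

  (* T01 and T12 place a tensor in two of the three factors; P and Q are
     Delta (x) id and id (x) Delta *)
  uq_coassoc : exists T01 T12 P Q : {linear uq2 -> uq3},
    [/\ tensor_extension (cp_ser uq3)
          (fun u v => cp_in uq3 0 u * cp_in uq3 1 v) T01,
        tensor_extension (cp_ser uq3)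
          (fun u v => cp_in uq3 1 u * cp_in uq3 2 v) T12,
        tensor_extension (cp_ser uq3)
          (fun u v => T01 (uq_Delta u) * cp_in uq3 2 v) P,
        tensor_extension (cp_ser uq3)
          (fun u v => cp_in uq3 0 u * T12 (uq_Delta v)) Q &
        forall u, P (uq_Delta u) = Q (uq_Delta u)];

  uq_eps : {lrmorphism uq -> K^o};
  uq_epsX : forall mu, uq_eps (uq_ser (fvar K mu)) = 0;
  uq_epsH : forall i, uq_eps (uq_h i) = 0;
  uq_counit : exists P Q : {linear uq2 -> uq},
    [/\ tensor_extension uq_ser (fun u v => uq_eps u *: v) P,
        tensor_extension uq_ser (fun u v => uq_eps v *: u) Q &
        forall u, P (uq_Delta u) = u /\ Q (uq_Delta u) = u];

  uq_S : {linear uq -> uq};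
  uq_antipode : exists P Q : {linear uq2 -> uq},
    [/\ tensor_extension uq_ser (fun u v => uq_S u * v) P,
        tensor_extension uq_ser (fun u v => u * uq_S v) Q &
        forall u, P (uq_Delta u) = (uq_eps u)%:A /\
                  Q (uq_Delta u) = (uq_eps u)%:A]
}.

End QuantumAlgebra.

Definition poisson_bracket (K : fieldType) (R : comAlgType K)
    (br : R -> R -> R) : Prop :=
  lie_bracket br /\ forall f g h, br f (g * h) = br f g * h + g * br f h.

(* Formal functions on a product, f (x) 1 and 1 (x) f being the renamings along
   inl and inr. A biderivation of power series is automatically continuous, so
   that br2 is determined by br. *)
Definition product_bracket (K : fieldType) (I : finType)
    (br : fps K I -> fps K I -> fps K I)
    (br2 : fps K (I + I)%type -> fps K (I + I)%type -> fps K (I + I)%type) :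
    Prop :=
  [/\ poisson_bracket br2,
      forall f g, br2 (fren inl f) (fren inl g) = fren inl (br f g),
      forall f g, br2 (fren inr f) (fren inr g) = fren inr (br f g) &
      forall f g, br2 (fren inl f) (fren inr g) = 0].

Section Coordinates.
Variables (K : fieldType) (m n : nat).

(* Coordinates of the dual group: inl i for H_i and inr mu for X^mu. *)
Definition gvar := ('I_m + 'I_n)%type.

Definition gfun := fps K gvar.

Definition gH (i : 'I_m) : gfun := fvar K (inl i : gvar).
Definition gX (mu : 'I_n) : gfun := fvar K (inr mu : gvar).

Definition gser (f : fps K 'I_n) : gfun := fren (fun mu => inr mu : gvar) f.

End Coordinates.

Arguments gH {K m n} i.
Arguments gX {K m n} mu.
Arguments gser {K m n} f.

Section DualGroup.
Variables (K : fieldType) (m n : nat).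
Variables (gam : 'I_n -> 'I_n -> 'I_n -> K) (alph : 'I_n -> 'I_m -> 'I_m -> K).

Local Notation gvar := (gvar m n).
Local Notation gfun := (gfun K m n).

Definition gmult (z : gvar) : fps K (gvar + gvar)%type :=
  match z with
  | inl i =>
      \sum_k fren inl (gser (exp_alpha alph i k)) * fren inr (gH k)
      + fren inl (gH i)
  | inr mu =>
      fren (fun t => match t with
                     | inl nu => inl (inr nu : gvar)
                     | inr nu => inr (inr nu : gvar)
                     end) (campbell_hausdorff gam mu)
  end.

(* Pull-back of formal functions along the group multiplication. *)
Definition gDelta : gfun -> fps K (gvar + gvar)%type := fsubst gmult.

Definition poisson_lie (br : gfun -> gfun -> gfun) : Prop :=
  poisson_bracket br /\
  exists2 br2, product_bracket br br2 &
    forall f g, gDelta (br f g) = br2 (gDelta f) (gDelta g).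

Variables (L : vectType K) (H : m.-tuple L) (X : n.-tuple L).

(* Differential at the identity, the cotangent space being identified with L
   through d H_i = tnth H i and d X^mu = tnth X mu. *)
Definition gdiff (f : gfun) : L :=
  \sum_i f (evar (inl i : gvar)) *: tnth H i
  + \sum_mu f (evar (inr mu : gvar)) *: tnth X mu.

Definition linearization (br : gfun -> gfun -> gfun) (b : L -> L -> L) : Prop :=
  forall f g, gdiff (br f g) = b (gdiff f) (gdiff g).

End DualGroup.

(* Main.v *)
From HB Require Import structures.
Require Import Defs.
From mathcomp Require Import all_boot all_order all_algebra.
From mathcomp Require Import boolp ring zify.

Set Implicit Arguments.
Unset Strict Implicit.
Unset Printing Implicit Defensive.

Import Order.TTheory GRing.Theory Num.Theory.
Local Open Scope ring_scope.

(** A Poisson-Lie bracket is determined by its linearization, so it suffices to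
    exhibit the brackets read off from U_q(L) as a solution of the same
    equations.

    On power series a biderivation is the contraction with a bivector field
    ([poisson_bivector]), and compatibility with the group multiplication says
    that this bivector field P is multiplicative: the pull-back of P_zz' along
    the multiplication is the bracket, for the product bivector field on pairs
    of points, of the components z and z' of the multiplication. In
    characteristic zero a multiplicative bivector field with vanishing linear
    part is zero ([multiplicative_eq0]): since the multiplication is x + y up to
    terms of order 2, the lowest homogeneous part of such a field would be an
    additive function of degree at least 2.

    The series C(X), A(X) define the bivector field [quantum_bivector]. Applying
    the coproduct to the commutation relations of U_q(L), and comparing
    coefficients in the completed tensor square, gives identities between power
    series ([quantum_hx], [quantum_hh]); the commutator with a generator H_i acts
    on the series in X as a vector field ([hslot_com_series]), hence these are
    the identities that express multiplicativity of [quantum_bivector]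
    ([quantum_multiplicative]). Its linear part is the Lie bracket of L by the
    conditions on C(0) and on the first derivatives of A at 0, together with
    the vanishing of the bracket on the invariant subspace of the involution
    ([gdiff_quantum_bivector]).

    All continuity arguments rest on [fps_rigid]. *)

(** * Coefficients of power series *)

Section Coefficients.
Variables (K : comNzRingType) (I : finType).
Implicit Types (f g : fps K I) (d a b : expo I).

Lemma edegD a b : edeg (a + b) = (edeg a + edeg b)%N.
Proof. by rewrite /edeg -big_split; apply: eq_bigr => i _; rewrite expoDE. Qed.

Lemma edeg_evar (i : I) : edeg (evar i) = 1%N.
Proof.
rewrite /edeg (bigD1 i) //= ffunE eqxx big1 // => j ji.
by rewrite ffunE (negbTE ji).
Qed.

Lemma edeg0 : edeg (0 : expo I) = 0%N.
Proof. by rewrite /edeg big1 // => i _; rewrite ffunE. Qed.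

Lemma edeg_eq0 d : (edeg d == 0%N) = (d == 0).
Proof.
apply/eqP/eqP => [d0|->]; last exact: edeg0.
by apply/ffunP => i; rewrite ffunE; apply/eqP; rewrite -leqn0 -d0 leq_edeg.
Qed.

Lemma edeg_gt0 d : (0 < edeg d)%N -> exists i, (0 < d i)%N.
Proof.
move=> d0; apply/existsP; apply: contraTT d0; rewrite negb_exists => /forallP d0.
rewrite -eqn0Ngt edeg_eq0; apply/eqP/ffunP => i; rewrite ffunE.
by have := d0 i; case: (d i).
Qed.

Lemma evarE (i j : I) : evar i j = (j == i).
Proof. by rewrite ffunE. Qed.

Lemma expo_addI a b b' : (a + b == a + b') = (b == b').
Proof.
apply/eqP/eqP => [/ffunP ab|-> //]; apply/ffunP => i.
by have := ab i; rewrite !expoDE => /addnI.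
Qed.

Lemma expo_pred d i : (0 < d i)%N -> exists d', d = d' + evar i.
Proof.
move=> di; exists [ffun j => (d j - (j == i))%N]; apply/ffunP => j.
rewrite expoDE !ffunE subnK //.
by case: eqP => // ->.
Qed.

Lemma evar_inj : injective (@evar I).
Proof.
by move=> i j /ffunP /(_ i); rewrite !evarE eqxx; case: eqP.
Qed.

Lemma vanishesD k f g : vanishes k f -> vanishes k g -> vanishes k (f + g).
Proof. by move=> hf hg d dk; rewrite fpsDE hf // hg // addr0. Qed.

Lemma vanishesN k f : vanishes k f -> vanishes k (- f).
Proof. by move=> hf d dk; rewrite fpsNE hf // oppr0. Qed.

Lemma vanishes_sum k (J : Type) (r : seq J) (P : pred J) (F : J -> fps K I) :
  (forall j, P j -> vanishes k (F j)) -> vanishes k (\sum_(j <- r | P j) F j).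
Proof. by move=> hF; elim/big_ind: _ => //; apply: vanishesD. Qed.

Lemma fpsME f g d : (f * g) d = fps_mul f g d.
Proof. by []. Qed.

Lemma vanishesM j k f g :
  vanishes j f -> vanishes k g -> vanishes (j + k) (f * g).
Proof.
move=> hf hg d dk; rewrite fpsME /fps_mul big1 // => a _; rewrite big1 // => b.
move=> /eqP ab; have {dk} : (edeg (ebv a + ebv b)%R < j + k)%N by rewrite ab.
rewrite edegD => dk.
have [aj|ja] := ltnP (edeg (ebv a)) j; first by rewrite hf // mul0r.
rewrite hg ?mulr0 // -(ltn_add2l j); apply: leq_ltn_trans dk.
by rewrite leq_add2r.
Qed.

Lemma vanishes0 f : vanishes 0 f. Proof. by []. Qed.

Lemma vanishes1 f : f 0 = 0 -> vanishes 1 f.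
Proof. by move=> f0 d; rewrite ltnS leqn0 edeg_eq0 => /eqP ->. Qed.

Lemma vanishesMl k f g : vanishes k g -> vanishes k (f * g).
Proof. exact: (vanishesM (vanishes0 f)). Qed.

Lemma vanishesMr k f g : vanishes k f -> vanishes k (f * g).
Proof. by rewrite mulrC; apply: vanishesMl. Qed.

Lemma vanishes_eq0 f : (forall k, vanishes k f) -> f = 0.
Proof. by move=> hf; apply/fpsP => d; apply: (hf (edeg d).+1). Qed.

Lemma fpsZE (c : K) f d : (c *: f) d = c * f d.
Proof. by []. Qed.

Lemma fps1E d : (1 : fps K I) d = (d == 0)%:R.
Proof. by []. Qed.

Lemma fpsM0E f g : (f * g) 0 = f 0 * g 0.
Proof.
rewrite fpsME (@fps_mulN _ _ 0); last by move=> i; rewrite ffunE.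
have e0 (a : ebox I 0) : ebv a = 0.
  by apply/ffunP => i; rewrite !ffunE; case: (a i) => -[].
have [a aE] : exists a : ebox I 0, ebv a = 0.
  by apply: ebv_ex => i; rewrite ffunE.
have ua (b : ebox I 0) : b = a by apply/ebv_inj; rewrite !e0.
rewrite (big_pred1 a) => [|b]; last by rewrite /= (ua b) eqxx.
by rewrite (big_pred1 a) => [|b] /=; rewrite ?(ua b) !e0 ?addr0 ?eqxx.
Qed.

Lemma fvar0E (i : I) : fvar K i 0 = 0.
Proof. by rewrite /fvar eq_sym -edeg_eq0 edeg_evar. Qed.

Lemma vanishes_fvar (i : I) : vanishes 1 (fvar K i).
Proof. exact/vanishes1/fvar0E. Qed.

Lemma fvar_evar (i j : I) :
  fvar K i (evar j) = (j == i)%:R.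
Proof. by rewrite /fvar (inj_eq evar_inj). Qed.

Lemma vanishes2 f :
  f 0 = 0 -> (forall i, f (evar i) = 0) -> vanishes 2 f.
Proof.
move=> f0 f1 d; have [/eqP|d0] := posnP (edeg d).
  by rewrite edeg_eq0 => /eqP ->.
have [i /expo_pred [d' ->]] : exists i, (0 < d i)%N.
  exact: edeg_gt0.
rewrite edegD edeg_evar addn1 !ltnS leqn0 edeg_eq0 => /eqP ->.
by rewrite add0r.
Qed.

Lemma lead0 (i j : I) f : vanishes 2 (f - (fvar K i + fvar K j)) -> f 0 = 0.
Proof.
by move=> /(_ 0); rewrite edeg0 fpsDE fpsNE fpsDE !fvar0E addr0 subr0 => ->.
Qed.

Lemma fvarME (i : I) f d : (fvar K i * f) (d + evar i) = f d.
Proof.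
rewrite fpsME /fps_mul; set N := edeg _.
have dN j : (d j <= N /\ evar i j <= N)%N.
  by have := leq_edeg (d + evar i) j; rewrite expoDE -/N; lia.
pose F a := \sum_(b : ebox I N | a + ebv b == d + evar i) fvar K i a * f (ebv b).
rewrite -[LHS]/(\sum_(a : ebox I N) F (ebv a)).
rewrite (bigID (fun a : ebox I N => ebv a == evar i)) /=
  [X in _ + X]big1 => [|a /negbTE ai].
  rewrite addr0 sum_ebv1 => [|j]; last by case: (dN j).
  rewrite /F (eq_bigl (fun b : ebox I N => ebv b == d)) => [|b]; last first.
    by rewrite [d + _]addrC expo_addI.
  rewrite (sum_ebv1 (fun b => fvar K i (evar i) * f b)) => [|j]; last by case: (dN j).
  by rewrite /fvar eqxx mul1r.
by rewrite /F big1 // => b _; rewrite /fvar ai mul0r.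
Qed.

Lemma fvarME0 (i : I) f d : d i = 0%N -> (fvar K i * f) d = 0.
Proof.
move=> di; rewrite fpsME /fps_mul big1 // => a _; rewrite big1 // => b /eqP ab.
rewrite /fvar; case: eqP => [ai|]; last by rewrite mul0r.
by have := di; rewrite -{1}ab expoDE ai evarE eqxx.
Qed.

(** The monomials whose first occurring variable is the i-th one, divided by that
    variable, make up q i. *)
Lemma fps_split f : exists q : I -> fps K I,
  f = f 0 *: 1 + \sum_i fvar K i * q i /\
  forall k, vanishes k.+1 f -> forall i, vanishes k (q i).
Proof.
pose q i : fps K I := fun d =>
  if [pick j | 0 < (d + evar i)%R j]%N == Some i then f (d + evar i) else 0.
exists q; split=> [|k fk i d dk]; last first.
  by rewrite /q; case: ifP => // _; rewrite fk // edegD edeg_evar addn1.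
apply/fpsP => d; rewrite fpsDE fpsZE fps1E fps_sumE.
have [->|d0] := eqVneq d 0.
  rewrite mulr1 big1 ?addr0 // => i _; by rewrite fvarME0 // ffunE.
rewrite mulr0 add0r.
case E : [pick j | (0 < d j)%N] => [j|]; last first.
  move: E; case: pickP => // d00 _; case/eqP: d0; apply/ffunP => i; rewrite ffunE.
  by have := d00 i; case: (d i).
have dj : (0 < d j)%N by move: E; case: pickP => // j' + [<-].
rewrite (bigD1 j) //= big1 ?addr0 => [|i ij].
  by case: (expo_pred dj) => d' dE; rewrite {2}dE fvarME /q -dE E eqxx.
have [|di] := posnP (d i); first exact: fvarME0.
case: (expo_pred di) => d' dE; rewrite dE fvarME /q -dE E.
by case: eqP => // -[ji]; rewrite ji eqxx in ij.
Qed.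

Definition fder (i : I) f : fps K I := fun d => f (d + evar i) *+ (d i).+1.

Lemma fder_linear (i : I) (c : K) f g : fder i (c *: f + g) = c *: fder i f + fder i g.
Proof.
by apply/fpsP => d; rewrite fpsDE fpsZE /fder fpsDE fpsZE mulrnDl mulrnAr.
Qed.

HB.instance Definition _ (i : I) :=
  GRing.isLinear.Build K (fps K I) (fps K I) _ (fder i) (fder_linear i).

Lemma fder1 (i : I) : fder i 1 = 0.
Proof.
apply/fpsP => d; rewrite /fder fps1E -edeg_eq0 edegD edeg_evar addn1 /=.
by rewrite mul0rn.
Qed.

Lemma fder_fvarM (i j : I) f :
  fder i (fvar K j * f) = (i == j)%:R * f + fvar K j * fder i f.
Proof.
apply/fpsP => d; rewrite fpsDE {1}/fder.
have dE a : (a + evar i) j = (a j + (i == j))%N by rewrite expoDE evarE eq_sym.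
have [dj|/expo_pred [d' ->{d}]] := posnP (d j).
  rewrite [X in _ = _ + X]fvarME0 // addr0; case: eqP => [->|ij].
    by rewrite fvarME mul1r dj.
  by rewrite mul0r fvarME0 ?mul0rn // dE dj; case: eqP.
rewrite addrAC !fvarME /fder.
case: eqP => [->|ij]; last first.
  by rewrite mul0r add0r expoDE evarE; case: eqP => // _; rewrite addn0.
by rewrite mul1r expoDE evarE eqxx addn1 mulrS.
Qed.

Lemma fder_fvar (i j : I) : fder i (fvar K j) = (i == j)%:R.
Proof. by rewrite -[fvar K j]mulr1 fder_fvarM fder1 mulr0 addr0 mulr1. Qed.

Lemma fder0E (i : I) f : fder i f 0 = f (evar i).
Proof. by rewrite /fder add0r ffunE. Qed.

Lemma vanishes_fder k (i : I) f : vanishes k.+1 f -> vanishes k (fder i f).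
Proof.
by move=> hf d dk; rewrite /fder hf ?mul0rn // edegD edeg_evar addn1.
Qed.

End Coefficients.

(** * Substitution *)

Section Substitution.
Variables (K : comNzRingType) (I J : finType) (g : I -> fps K J).

Definition fmon (a : expo I) : fps K J := \prod_i g i ^+ a i.

Lemma fmonD a b : fmon (a + b) = fmon a * fmon b.
Proof.
by rewrite /fmon -big_split; apply: eq_bigr => i _; rewrite expoDE exprD.
Qed.

Lemma fmon_evar i : fmon (evar i) = g i.
Proof.
rewrite /fmon (bigD1 i) //= evarE eqxx big1 ?mulr1 // => j ji.
by rewrite evarE (negbTE ji).
Qed.

Lemma fmon0 : fmon 0 = 1.
Proof. by rewrite /fmon big1 // => i _; rewrite ffunE. Qed.

Lemma fsubst_linear (c : K) f f' :
  fsubst g (c *: f + f') = c *: fsubst g f + fsubst g f'.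
Proof.
apply/fpsP => d; rewrite fpsDE fpsZE /fsubst mulr_sumr -big_split /=.
by apply: eq_bigr => a _; rewrite fpsDE fpsZE mulrDl mulrA.
Qed.

HB.instance Definition _ :=
  GRing.isLinear.Build K (fps K I) (fps K J) _ (fsubst g) fsubst_linear.

Lemma fsubst1 : fsubst g 1 = 1.
Proof.
apply/fpsP => d; rewrite /fsubst -/fmon.
rewrite (bigID (fun a : ebox I _ => ebv a == 0)) /= [X in _ + X]big1; last first.
  by move=> a /negbTE a0; rewrite fps1E a0 mul0r.
rewrite addr0 (sum_ebv1 (fun a => (1 : fps K I) a * fmon a d)) => [|i]; last first.
  by rewrite ffunE.
by rewrite fmon0 [(1 : fps K I) 0]fps1E eqxx mul1r.
Qed.

Hypothesis g0 : forall i, g i 0 = 0.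

Lemma vanishes_fmon a : vanishes (edeg a) (fmon a).
Proof.
rewrite /edeg /fmon; elim/big_rec2: _ => [|i p k _ IH]; first exact: vanishes0.
apply: vanishesM IH; elim: (a i) => [|q IHq]; first exact: vanishes0.
by rewrite exprS -add1n; apply: vanishesM IHq; apply/vanishes1/g0.
Qed.

(** The range of summation may be enlarged, monomials of degree above edeg d
    having no coefficient d. *)
Lemma fsubst_box N f d : (edeg d <= N)%N ->
  fsubst g f d = \sum_(a : ebox I N) f (ebv a) * fmon (ebv a) d.
Proof.
move=> dN; rewrite /fsubst -/fmon.
pose F (a : expo I) := f a * fmon a d.
pose P (a : expo I) := [forall i, (a i <= edeg d)%N].
have F0 a : ~~ P a -> F a = 0.
  rewrite negb_forall => /existsP [i]; rewrite -ltnNge => di.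
  by rewrite /F vanishes_fmon ?mulr0 // (leq_trans di) // leq_edeg.
rewrite [LHS](bigID (fun a : ebox I _ => P (ebv a))) /=.
rewrite [X in _ + X]big1 ?addr0; last by move=> a; apply: F0.
rewrite [RHS](bigID (fun a : ebox I _ => P (ebv a))) /=.
rewrite [X in _ = _ + X]big1 ?addr0; last by move=> a; apply: F0.
apply: (@sum_ebv_indep _ _ _ _ P F) => a /forallP ad i //.
exact: leq_trans dN.
Qed.

Lemma vanishes_fsubst k f : vanishes k f -> vanishes k (fsubst g f).
Proof.
move=> hf d dk; rewrite /fsubst -/fmon big1 // => a _.
have [ak|ka] := ltnP (edeg (ebv a)) k; first by rewrite hf // mul0r.
by rewrite -/(fmon _) vanishes_fmon ?mulr0 //; apply: leq_trans ka.
Qed.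

Lemma fsubst_fvarM i f : fsubst g (fvar K i * f) = g i * fsubst g f.
Proof.
apply/fpsP => d; set N := edeg d.
pose T : fps K J := \sum_(a : ebox I N) f (ebv a) *: fmon (ebv a).
have -> : (g i * fsubst g f) d = (g i * T) d.
  have /(_ d) : vanishes N.+1 (g i * fsubst g f - g i * T).
    rewrite -mulrBr; apply: vanishesMl => d' d'N.
    rewrite fpsDE fpsNE (fsubst_box _ d'N) /T fps_sumE.
    by apply/eqP; rewrite subr_eq0; apply/eqP; apply: eq_bigr => a _; rewrite fpsZE.
  by move=> /(_ (leqnn _)) /eqP; rewrite fpsDE fpsNE subr_eq0 => /eqP.
rewrite /T mulr_sumr fps_sumE /fsubst -/fmon -/N.
under [RHS]eq_bigr => a _ do
  rewrite -scalerAr -{1}(fmon_evar i) -fmonD addrC fpsZE.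
transitivity (\sum_(b : ebox I N) \sum_(a : ebox I N | ebv a + evar i == ebv b)
    f (ebv a) * fmon (ebv b) d).
  apply: eq_bigr => b _; rewrite -/(fmon _).
  have [bi|/expo_pred [b' bE]] := posnP (ebv b i).
    rewrite fvarME0 // mul0r big1 // => a /eqP ab.
    by move: bi; rewrite -ab expoDE evarE eqxx addn1.
  rewrite bE fvarME (eq_bigl (fun a : ebox I N => ebv a == b')) => [|a]; last first.
    by rewrite ![_ + evar i]addrC expo_addI.
  rewrite (@sum_ebv1 _ _ _ b' (fun a => f a * _)) // => j.
  have : (ebv b j <= N)%N by rewrite ffunE -ltnS.
  by rewrite bE expoDE => /(leq_trans _)-> //; rewrite leq_addr.
rewrite (exchange_big_dep xpredT) //=; apply: eq_bigr => a _.
have [aN|Na] := leqP (edeg (ebv a + evar i)%R) N.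
  rewrite (eq_bigl (fun b : ebox I N => ebv b == ebv a + evar i)) => [|b]; last first.
    by rewrite eq_sym.
  rewrite (sum_ebv1 (fun b => f (ebv a) * fmon b d)) // => j.
  exact: leq_trans (leq_edeg _ j) aN.
rewrite [fmon (ebv a + _) d]vanishes_fmon // mulr0 big1 // => b /eqP <-.
by rewrite vanishes_fmon // mulr0.
Qed.

Lemma fsubst_fvar i : fsubst g (fvar K i) = g i.
Proof. by rewrite -[fvar K i]mulr1 fsubst_fvarM fsubst1 mulr1. Qed.

Lemma fsubst0E f : fsubst g f 0 = f 0.
Proof.
have : vanishes 1 (fsubst g (f - f 0 *: 1)).
  by apply/vanishes_fsubst/vanishes1; rewrite fpsDE fpsNE fpsZE fps1E eqxx mulr1 subrr.
move=> /(_ 0); rewrite edeg0 linearB linearZ /= fsubst1 => /(_ isT) /eqP.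
by rewrite fpsDE fpsNE fpsZE fps1E eqxx mulr1 subr_eq0 => /eqP.
Qed.

End Substitution.

(** Substitutions that agree to first order agree on the lowest homogeneous
    part of a series. *)
Lemma fsubst_lead (K : comNzRingType) (I J : finType) (g g' : I -> fps K J) :
  (forall i, g i 0 = 0) -> (forall i, vanishes 2 (g i - g' i)) ->
  forall k f, vanishes k f -> vanishes k.+1 (fsubst g f - fsubst g' f).
Proof.
move=> g0 gg'; have g'0 i : g' i 0 = 0.
  have := gg' i 0; rewrite edeg0 fpsDE fpsNE g0 sub0r => /(_ isT)/eqP.
  by rewrite oppr_eq0 => /eqP.
elim=> [|k IH] f fk.
  by apply: vanishes1; rewrite fpsDE fpsNE !fsubst0E // subrr.
have [q [fE /(_ k fk) qk]] := fps_split f.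
rewrite fE fk ?edeg0 // scale0r add0r !linear_sum /= -big_split /=.
apply: vanishes_sum => i _; rewrite !fsubst_fvarM //.
rewrite (_ : _ - _ = (g i - g' i) * fsubst g (q i)
  + g' i * (fsubst g (q i) - fsubst g' (q i))); last by ring.
apply: vanishesD; first exact: (vanishesM (gg' i) (vanishes_fsubst g0 (qk i))).
exact: (vanishesM (vanishes1 (g'0 i)) (IH _ (qk i))).
Qed.

(** * Rigidity of linear maps on power series *)

(** The topology of the series variables on W is Hausdorff. *)
Definition series_separated (K : fieldType) (I : finType) (W : algType K)
    (iota : fps K I -> W) : Prop :=
  forall w, (forall k, series_nbhs iota k w) -> w = 0.

Section Neighbourhoods.
Variables (K : fieldType) (I : finType) (W : algType K).
Variable iota : {lrmorphism fps K I -> W}.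

Lemma series_nbhs0 w : series_nbhs iota 0 w.
Proof.
exists [:: (1, w)] => [u _|]; first exact: vanishes0.
by rewrite big_seq1 rmorph1 mul1r.
Qed.

Lemma series_nbhsD k v w :
  series_nbhs iota k v -> series_nbhs iota k w -> series_nbhs iota k (v + w).
Proof.
move=> [s sk ->] [t tk ->]; exists (s ++ t); last by rewrite big_cat.
by move=> u; rewrite mem_cat => /orP[/sk|/tk].
Qed.

Lemma series_nbhs_sum k (J : Type) (r : seq J) (F : J -> W) :
  (forall j, series_nbhs iota k (F j)) -> series_nbhs iota k (\sum_(j <- r) F j).
Proof.
move=> hF; elim/big_ind: _ => //; first by exists [::] => //; rewrite big_nil.
exact: series_nbhsD.
Qed.

Lemma series_nbhsM k (g : fps K I) w : g 0 = 0 ->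
  series_nbhs iota k w -> series_nbhs iota k.+1 (iota g * w).
Proof.
move=> g0 [s sk ->]; exists [seq (g * u.1, u.2) | u <- s] => [u|].
  by move=> /mapP [v /sk vk -> /=]; apply: (vanishesM (vanishes1 g0)).
rewrite big_map mulr_sumr; apply: eq_bigr => u _ /=.
by rewrite rmorphM mulrA.
Qed.

End Neighbourhoods.

Lemma fps_separated (K : fieldType) (I : finType) :
  series_separated (idfun : fps K I -> fps K I).
Proof.
move=> w wk; apply: vanishes_eq0 => k; have [s sk ->] := wk k.
by rewrite big_seq; apply: vanishes_sum => u /sk; apply: vanishesMr.
Qed.

(** Two linear maps whose difference turns multiplication by each variable into
    multiplication by a series of positive order are equal: splitting off
    variables from f one at a time shows that the difference sends f to every
    neighbourhood of 0. Continuity of morphisms and derivations of power series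
    is thus automatic, and so is every identity between them that holds on the
    variables. *)
Lemma fps_rigid (K : fieldType) (I J : finType) (W : algType K)
    (iota : {lrmorphism fps K J -> W}) (g : I -> fps K J) (F G : fps K I -> W) :
  series_separated iota -> (forall i, g i 0 = 0) -> linear F -> linear G ->
  F 1 = G 1 ->
  (forall i f, F (fvar K i * f) - G (fvar K i * f) = iota (g i) * (F f - G f)) ->
  F =1 G.
Proof.
move=> sep g0 Flin Glin F1 FGM f; apply/eqP; rewrite -subr_eq0; apply/eqP.
apply: sep => k.
pose E f := F f - G f.
have Elin : linear E.
  by move=> c u v; rewrite /E Flin Glin scalerBr opprD addrACA.
pose El : {linear fps K I -> W} := HB.pack E (GRing.isLinear.Build K _ _ _ E Elin).
rewrite -[_ - _]/(E f).
elim: k f => [|k IH] f; first exact: series_nbhs0.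
have [q [-> _]] := fps_split f.
rewrite Elin {1}/E F1 subrr scaler0 add0r -[E _]/(El _) linear_sum.
apply: series_nbhs_sum => i; rewrite /= /E FGM.
exact: (series_nbhsM (g0 i) (IH (q i))).
Qed.

Lemma fps_rigid_fps (K : fieldType) (I J : finType) (g : I -> fps K J)
    (F G : fps K I -> fps K J) :
  (forall i, g i 0 = 0) -> linear F -> linear G -> F 1 = G 1 ->
  (forall i f, F (fvar K i * f) - G (fvar K i * f) = g i * (F f - G f)) ->
  F =1 G.
Proof. exact: (@fps_rigid _ _ _ _ (@idfun (fps K J)) g F G (@fps_separated K J)). Qed.

(** For fixed h both sides are linear in f and agree after multiplication of f
    by a variable as soon as they agree on f. *)
Lemma fder_leibniz (K : fieldType) (I : finType) (i : I) (f h : fps K I) :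
  fder i (f * h) = fder i f * h + f * fder i h.
Proof.
move: f; apply: (fps_rigid_fps (g := @fvar K I) (F := fun f => fder i (f * h))
  (G := fun f => fder i f * h + f * fder i h)).
- exact: fvar0E.
- by move=> c u v; rewrite mulrDl -scalerAl linearP.
- move=> c u v; rewrite linearP !mulrDl -!scalerAl scalerDr; exact: addrACA.
- by rewrite fder1 mul0r !mul1r add0r.
- by move=> j u; rewrite -mulrA !fder_fvarM; ring.
Qed.

Lemma fpsM_evar (K : fieldType) (I : finType) (f h : fps K I) i :
  (f * h) (evar i) = f (evar i) * h 0 + f 0 * h (evar i).
Proof. by rewrite -fder0E fder_leibniz fpsDE !fpsM0E !fder0E. Qed.

Section SubstitutionMorphism.
Variables (K : fieldType) (I J : finType) (g : I -> fps K J).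
Hypothesis g0 : forall i, g i 0 = 0.

Lemma fsubstM (f h : fps K I) : fsubst g (f * h) = fsubst g f * fsubst g h.
Proof.
move: f; apply: (fps_rigid_fps (g := g) (F := fun f => fsubst g (f * h))
  (G := fun f => fsubst g f * fsubst g h)) => //.
- by move=> c u v; rewrite mulrDl -scalerAl linearP.
- by move=> c u v; rewrite linearP mulrDl -scalerAl.
- by rewrite mul1r fsubst1 mul1r.
- by move=> i u; rewrite -mulrA !fsubst_fvarM //; ring.
Qed.

(** Both sides are linear in f and change in the same way under
    multiplication by a variable. *)
Lemma fder_fsubst (j : J) f :
  fder j (fsubst g f) = \sum_i fsubst g (fder i f) * fder j (g i).
Proof.
move: f; apply: (fps_rigid_fps (g := g) (F := fun f => fder j (fsubst g f))
  (G := fun f => \sum_i fsubst g (fder i f) * fder j (g i))) => //.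
- by move=> c u v; rewrite !linearP.
- move=> c u v; rewrite scaler_sumr -big_split.
  by apply: eq_bigr => i _; rewrite !linearP /= mulrDl scalerAl.
- by rewrite fsubst1 fder1 big1 // => i _; rewrite fder1 linear0 mul0r.
- move=> i u; rewrite fsubst_fvarM // fder_leibniz.
  rewrite mulrBr mulr_sumr.
  rewrite (eq_bigr (fun l => (l == i)%:R * (fsubst g u * fder j (g l))
     + g i * (fsubst g (fder l u) * fder j (g l)))); last first.
    move=> l _; rewrite fder_fvarM linearD /= fsubst_fvarM //.
    by case: eqP => _; rewrite ?mul1r ?mul0r ?linear0; ring.
  rewrite big_split /= (bigD1 i) //= eqxx big1; last first.
    by move=> l /negbTE ->; rewrite mul0r.
  by rewrite mul1r addr0; ring.
Qed.

End SubstitutionMorphism.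

(** The difference of the two sides is a derivation that kills the variables. *)
Lemma derivation_fps (K : fieldType) (I : finType) (W : algType K)
    (iota : {lrmorphism fps K I -> W}) (D : fps K I -> W) (a : I -> fps K I) :
  series_separated iota -> linear D ->
  (forall f h, D (f * h) = D f * iota h + iota f * D h) ->
  (forall i, D (fvar K i) = iota (a i)) ->
  forall f, D f = iota (\sum_i fder i f * a i).
Proof.
move=> sep Dlin DM Da.
have D1 : D 1 = 0.
  have /eqP := DM 1 1; rewrite !mulr1 rmorph1 mulr1 mul1r.
  by rewrite addrC -subr_eq0 opprD addrA subrr sub0r oppr_eq0 => /eqP.
apply: (fps_rigid (iota := iota) (g := @fvar K I) (F := D)
  (G := fun f => iota (\sum_i fder i f * a i))) => //.
- exact: fvar0E.
- move=> c u v; rewrite -linearP scaler_sumr -big_split.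
  by congr (iota _); apply: eq_bigr => i _; rewrite linearP mulrDl scalerAl.
- by rewrite D1 big1 ?rmorph0 // => i _; rewrite fder1 mul0r.
- move=> i u; rewrite DM Da mulrBr -!rmorphM mulr_sumr.
  rewrite (eq_bigr (fun l => (l == i)%:R * (u * a l)
      + fvar K i * (fder l u * a l))); last first.
    by move=> l _; rewrite fder_fvarM; ring.
  rewrite big_split /= (bigD1 i) //= eqxx big1; last first.
    by move=> l /negbTE ->; rewrite mul0r.
  by rewrite addr0 mul1r [a i * u]mulrC rmorphD /= opprD addrACA subrr add0r.
Qed.

(** * Renaming of variables *)

Lemma fren_fvar0 (K : fieldType) (I J : finType) (r : I -> J) i :
  fvar K (r i) 0 = 0.
Proof. exact: fvar0E. Qed.

Section Renaming.
Variables (K : fieldType) (I J : finType) (r : I -> J).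
Implicit Types f : fps K I.

HB.instance Definition _ := GRing.isLinear.Build K (fps K I) (fps K J) _
  (@fren K I J r) (@fsubst_linear K I J (fun i => fvar K (r i))).
Fact fren_monoid : monoid_morphism (@fren K I J r).
Proof.
split; [exact: fsubst1|apply: fsubstM; exact: fren_fvar0].
Qed.
HB.instance Definition _ := GRing.isMonoidMorphism.Build (fps K I) (fps K J)
  (@fren K I J r) fren_monoid.

Lemma fren_fvar i : fren r (fvar K i) = fvar K (r i).
Proof. exact/fsubst_fvar/fren_fvar0. Qed.

Lemma fder_fren j f :
  fder j (fren r f) = \sum_i fren r (fder i f) * (j == r i)%:R.
Proof.
rewrite [LHS](fder_fsubst (fren_fvar0 K r)).
by apply: eq_bigr => i _; rewrite fder_fvar.
Qed.

Lemma fren0E f :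
  fren r f 0 = f 0.
Proof. exact: (fsubst0E (fren_fvar0 K r)). Qed.

Lemma fren_evar f j :
  fren r f (evar j) = \sum_i f (evar i) *+ (j == r i).
Proof.
rewrite -fder0E fder_fren fps_sumE; apply: eq_bigr => i _.
rewrite fpsM0E fren0E fder0E.
by case: eqP => _; rewrite ?mulr1n ?mulr0n ?mulr0 // fps1E eqxx mulr1.
Qed.

End Renaming.

Lemma fren_comp (K : fieldType) (I J L : finType) (r : I -> J) (r' : J -> L)
    (f : fps K I) : fren r' (fren r f) = fren (r' \o r) f.
Proof.
move: f; apply: (fps_rigid_fps (g := fun i => fvar K (r' (r i)))
  (F := fun f => fren r' (fren r f)) (G := fren (r' \o r))).
- by move=> i; apply: fvar0E.
- by move=> c u v; rewrite !linearP.
- by move=> c u v; rewrite linearP.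
- by rewrite !rmorph1.
- by move=> i u; rewrite !rmorphM /= !fren_fvar mulrBr.
Qed.

(** * Free modules over power series *)

Section SeriesBasis.
Variables (K : fieldType) (I : finType) (W : algType K) (E : eqType).
Variables (iota : {lrmorphism fps K I -> W}) (b : E -> W).
Hypothesis hb : series_basis iota b.
Implicit Types l : seq (fps K I * E).

Lemma sum_collect l : let s := undup [seq u.2 | u <- l] in
  \sum_(u <- l) iota u.1 * b u.2 =
  \sum_(e <- s) iota (\sum_(u <- l | u.2 == e) u.1) * b e.
Proof.
move=> s; under [RHS]eq_bigr => e _ do
  rewrite linear_sum mulr_suml big_mkcond /=.
rewrite [RHS]exchange_big /= [RHS]big_seq [LHS]big_seq.
apply: eq_bigr => u ul.
have u2s : u.2 \in s by rewrite mem_undup map_f.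
rewrite (bigD1_seq u.2) ?undup_uniq //= eqxx big1_seq ?addr0 //.
by move=> e /andP[ne _]; rewrite eq_sym (negbTE ne).
Qed.

Lemma series_basis_coef l : \sum_(u <- l) iota u.1 * b u.2 = 0 ->
  forall e, \sum_(u <- l | u.2 == e) u.1 = 0.
Proof.
rewrite sum_collect => l0 e.
have [es|es] := boolP (e \in undup [seq u.2 | u <- l]).
  exact: (hb.2 _ (fun e => \sum_(u <- l | u.2 == e) u.1) (undup_uniq _) l0 e es).
rewrite big_seq_cond big1 // => u /andP[ul /eqP ue]; case/negP: es.
by rewrite mem_undup -ue map_f.
Qed.

Lemma series_basis_free (T : finType) (e : T -> E) (u : T -> fps K I) :
  injective e -> \sum_t iota (u t) * b (e t) = 0 -> forall t, u t = 0.
Proof.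
move=> einj u0 t; pose l := [seq (u t, e t) | t <- index_enum T].
have := @series_basis_coef l _ (e t).
rewrite !big_map => /(_ u0).
by rewrite (big_pred1 t) // => t' /=; rewrite (inj_eq einj).
Qed.

Lemma series_basis_inj e : b e = 1 -> injective iota.
Proof.
move=> be f h fh; apply/eqP; rewrite -subr_eq0; apply/eqP.
apply: (@series_basis_free unit (fun=> e) (fun=> f - h) _ _ tt) => [[] []//|].
by rewrite big_const card_unit /= be mulr1 raddfB /= fh subrr addr0.
Qed.

Lemma series_basis_nbhs k w : series_nbhs iota k w ->
  exists2 l, forall u, u \in l -> vanishes k u.1 &
             w = \sum_(u <- l) iota u.1 * b u.2.
Proof.
move=> [s sk ->]; elim: s sk => [|[f v] s IH] sk.
  by exists [::] => //; rewrite !big_nil.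
have [|l lk lE] := IH; first by move=> u us; apply: sk; rewrite in_cons us orbT.
have [t [g ->]] := hb.1 v.
exists ([seq (f * g e, e) | e <- t] ++ l) => [u|].
  rewrite mem_cat => /orP[/mapP [e _ ->] /=|/lk //].
  by apply: vanishesMr; apply: (sk (f, v)); rewrite in_cons eqxx.
rewrite big_cons big_cat /= -lE big_map mulr_sumr; congr (_ + _).
by apply: eq_bigr => e _ /=; rewrite rmorphM mulrA.
Qed.

(** The coordinates of an element of all the neighbourhoods of 0 vanish to
    every order. *)
Lemma series_basis_separated : series_separated iota.
Proof.
move=> w wk; have [l _ lE] := series_basis_nbhs (wk 0%N).
suff l0 e : \sum_(u <- l | u.2 == e) u.1 = 0.
  rewrite lE sum_collect.
  by rewrite big1 // => e _; rewrite l0 rmorph0 mul0r.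
apply: vanishes_eq0 => k; have [l' l'k l'E] := series_basis_nbhs (wk k).
have /series_basis_coef /(_ e) : \sum_(u <- l ++ [seq (- u.1, u.2) | u <- l'])
    iota u.1 * b u.2 = 0.
  rewrite big_cat /= big_map -lE l'E -big_split big1 // => u _ /=.
  by rewrite raddfN mulNr subrr.
rewrite big_cat big_map /= => /eqP; rewrite addr_eq0 => /eqP ->.
apply: vanishesN; rewrite big_seq_cond; apply: vanishes_sum => u /andP[/l'k uk _].
exact: vanishesN.
Qed.

End SeriesBasis.

(** * Bivector fields *)

Lemma lie_bracket_anti (K : fieldType) (W : lmodType K) (br : W -> W -> W) :
  lie_bracket br -> forall x y, br x y = - br y x.
Proof.
move=> [linr linl alt _] x y; apply/eqP; rewrite -addr_eq0.
have Dl u v w : br (u + v) w = br u w + br v w.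
  by have := linl w 1 u v; rewrite !scale1r.
have Dr u v w : br w (u + v) = br w u + br w v.
  by have := linr w 1 u v; rewrite !scale1r.
by have /eqP := alt (x + y); rewrite Dl !Dr !alt add0r addr0.
Qed.

Section Bivectors.
Variables (K : fieldType) (I : finType).
Implicit Types (f g h : fps K I) (P : I -> I -> fps K I).

Definition bivector_bracket P f g :=
  \sum_s \sum_t fder s f * fder t g * P s t.

Lemma bivectorDl P f g h :
  bivector_bracket P (f + g) h = bivector_bracket P f h + bivector_bracket P g h.
Proof.
rewrite -big_split; apply: eq_bigr => s _; rewrite -big_split.
by apply: eq_bigr => t _; rewrite linearD /=; ring.
Qed.

Lemma bivectorDr P f g h :
  bivector_bracket P f (g + h) = bivector_bracket P f g + bivector_bracket P f h.
Proof.
rewrite -big_split; apply: eq_bigr => s _; rewrite -big_split.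
by apply: eq_bigr => t _; rewrite linearD /=; ring.
Qed.

Lemma bivector0l P f : bivector_bracket P 0 f = 0.
Proof.
by rewrite /bivector_bracket big1 // => s _; rewrite big1 // => t _;
  rewrite linear0 !mul0r.
Qed.

Lemma bivector0r P f : bivector_bracket P f 0 = 0.
Proof.
by rewrite /bivector_bracket big1 // => s _; rewrite big1 // => t _;
  rewrite linear0 mulr0 mul0r.
Qed.

Lemma bivector_suml P (J : Type) (r : seq J) (F : J -> fps K I) h :
  bivector_bracket P (\sum_(j <- r) F j) h =
  \sum_(j <- r) bivector_bracket P (F j) h.
Proof.
exact: (big_morph (bivector_bracket P ^~ h) (fun f g => bivectorDl P f g h)
  (bivector0l P h)).
Qed.

Lemma bivector_sumr P (J : Type) (r : seq J) (F : J -> fps K I) h :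
  bivector_bracket P h (\sum_(j <- r) F j) =
  \sum_(j <- r) bivector_bracket P h (F j).
Proof.
exact: (big_morph (bivector_bracket P h) (bivectorDr P h) (bivector0r P h)).
Qed.

Lemma bivectorMl P f g h : bivector_bracket P (f * g) h =
  bivector_bracket P f h * g + f * bivector_bracket P g h.
Proof.
rewrite mulr_suml mulr_sumr -big_split; apply: eq_bigr => s _.
rewrite mulr_suml mulr_sumr -big_split; apply: eq_bigr => t _ /=.
by rewrite fder_leibniz; ring.
Qed.

Lemma bivectorMr P f g h : bivector_bracket P f (g * h) =
  bivector_bracket P f g * h + g * bivector_bracket P f h.
Proof.
rewrite mulr_suml mulr_sumr -big_split; apply: eq_bigr => s _.
rewrite mulr_suml mulr_sumr -big_split; apply: eq_bigr => t _ /=.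
by rewrite fder_leibniz; ring.
Qed.

Lemma bivector_varl P i g :
  bivector_bracket P (fvar K i) g = \sum_t fder t g * P i t.
Proof.
rewrite /bivector_bracket (bigD1 i) //= [X in _ + X]big1 ?addr0 => [|s si].
  by apply: eq_bigr => t _; rewrite fder_fvar eqxx mul1r.
by rewrite big1 // => t _; rewrite fder_fvar (negbTE si) !mul0r.
Qed.

Lemma bivector_var P i j :
  bivector_bracket P (fvar K i) (fvar K j) = P i j.
Proof.
rewrite bivector_varl (bigD1 j) //= fder_fvar eqxx mul1r big1 ?addr0 // => t tj.
by rewrite fder_fvar (negbTE tj) mul0r.
Qed.

Lemma bivectorB P Q f g :
  bivector_bracket (fun s t => P s t - Q s t) f g =
  bivector_bracket P f g - bivector_bracket Q f g.
Proof.
rewrite -sumrB; apply: eq_bigr => s _; rewrite -sumrB.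
by apply: eq_bigr => t _; rewrite mulrBr.
Qed.

Lemma vanishes_bivector P k f g : (forall s t, vanishes k (P s t)) ->
  vanishes 2 f \/ vanishes 2 g -> vanishes k.+1 (bivector_bracket P f g).
Proof.
move=> Pk fg; apply: vanishes_sum => s _; apply: vanishes_sum => t _.
rewrite -add1n; apply: vanishesM => //.
by case: fg => /vanishes_fder h; [apply: vanishesMr|apply: vanishesMl].
Qed.

(** In each argument the bracket is a derivation of power series, hence given by
    partial derivatives. *)
Lemma poisson_bivector (br : fps K I -> fps K I -> fps K I) :
  poisson_bracket br ->
  forall f g, br f g = bivector_bracket (fun s t => br (fvar K s) (fvar K t)) f g.
Proof.
move=> [lie lei]; have anti := lie_bracket_anti lie; have [linr linl _ _] := lie.
have der D a : linear D -> (forall f h, D (f * h) = D f * h + f * D h) ->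
    (forall i, D (fvar K i) = a i) -> forall f, D f = \sum_i fder i f * a i.
  exact: (@derivation_fps K I _ (@idfun (fps K I)) D a (@fps_separated K I)).
move=> f g.
have lei' u v : br (u * v) g = br u g * v + u * br v g.
  by rewrite !(anti _ g) lei; ring.
rewrite [LHS](der (br^~ g) (fun s => br (fvar K s) g) (linl g)
  (fun u v => lei' u v) (fun=> erefl)).
apply: eq_bigr => s _.
rewrite (der (br (fvar K s)) (fun t => br (fvar K s) (fvar K t))
  (linr _) (lei _) (fun=> erefl)).
by rewrite mulr_sumr; apply: eq_bigr => t _; rewrite mulrA.
Qed.

End Bivectors.

Definition product_bivector (K : fieldType) (I : finType)
    (P : I -> I -> fps K I) (s t : I + I) : fps K (I + I)%type :=
  match s, t with
  | inl a, inl b => fren inl (P a b)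
  | inr a, inr b => fren inr (P a b)
  | _, _ => 0
  end.

Lemma product_bracketE (K : fieldType) (I : finType)
    (br : fps K I -> fps K I -> fps K I)
    (br2 : fps K (I + I)%type -> fps K (I + I)%type -> fps K (I + I)%type) :
  product_bracket br br2 -> forall f g, br2 f g = bivector_bracket
    (product_bivector (fun s t => br (fvar K s) (fvar K t))) f g.
Proof.
move=> [pb ll rr lr] f g; rewrite (poisson_bivector pb).
apply: eq_bigr => s _; apply: eq_bigr => t _; congr (_ * _).
case: s t => [a|a] [b|b] /=; rewrite -!fren_fvar //.
by rewrite (lie_bracket_anti pb.1) lr oppr0.
Qed.

(** * Uniqueness of multiplicative bivector fields *)

Section Uniqueness.
Variables (K : numFieldType) (I : finType) (mul : I -> fps K (I + I)%type).
Hypothesis mul_lead :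
  forall z, vanishes 2 (mul z - (fvar K (inl z) + fvar K (inr z))).

Local Notation add := (fun z : I => fvar K (inl z) + fvar K (inr z)).

Lemma add0E z : add z 0 = 0.
Proof. by rewrite /= fpsDE !fvar0E addr0. Qed.

Lemma mul0E z : mul z 0 = 0.
Proof. exact: lead0 (@mul_lead z). Qed.

(* Restriction to x = 0 of functions of a pair (x, y). *)
Local Notation second := (fun s : I + I =>
  match s with inl _ => 0 | inr b => fvar K b end).

Lemma second0E s : second s 0 = 0.
Proof. by case: s => // b; apply: fvar0E. Qed.

Lemma fsubst_second_add (f : fps K I) : fsubst second (fsubst add f) = f.
Proof.
move: f; apply: (fps_rigid_fps (g := @fvar K I)
  (F := fun f => fsubst second (fsubst add f)) (G := idfun)) => //.
- exact: fvar0E.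
- by move=> c u v; rewrite !linearP.
- by rewrite !fsubst1.
move=> i u /=; rewrite fsubst_fvarM ?fsubstM; try exact: add0E || exact: second0E.
by rewrite linearD /= !fsubst_fvar ?add0r ?mulrBr //; exact: second0E.
Qed.

Lemma fsubst_second_inl (f : fps K I) : fsubst second (fren inl f) = f 0 *: 1.
Proof.
move: f; apply: (fps_rigid_fps (g := fun=> 0)
  (F := fun f => fsubst second (fren inl f)) (G := fun f => f 0 *: 1)) => //.
- by move=> c u v; rewrite !linearP.
- by move=> c u v; rewrite fpsDE fpsZE scalerDl scalerA.
- by rewrite rmorph1 fsubst1 fps1E eqxx scale1r.
move=> i u; rewrite rmorphM /= fsubstM; last exact: second0E.
rewrite fren_fvar fsubst_fvar; last exact: second0E.
by rewrite !mul0r fpsM0E fvar0E mul0r scale0r subrr.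
Qed.

Variable Q : I -> I -> fps K I.
Hypothesis Qmul : forall z z', fsubst mul (Q z z') =
  bivector_bracket (product_bivector Q) (mul z) (mul z').
Hypothesis Qlin : forall z z' i, Q z z' (evar i) = 0.

(** Modulo order k + 1 only the linear parts of the multiplication enter, on
    both sides of the multiplicativity equation. *)
Lemma multiplicative_lead k : (forall z z', vanishes k (Q z z')) ->
  forall z z', vanishes k.+1
    (fsubst add (Q z z') - (fren inl (Q z z') + fren inr (Q z z'))).
Proof.
move=> Qk z z'.
have Pk s t : vanishes k (product_bivector Q s t).
  by case: s t => [a|a] [b|b] //=; apply: vanishes_fsubst => //; apply: fren_fvar0.
have -> : fren inl (Q z z') + fren inr (Q z z') =
    bivector_bracket (product_bivector Q) (add z) (add z').
  by rewrite bivectorDl !bivectorDr !bivector_var /= addr0 add0r.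
rewrite (_ : _ - _ = - (fsubst mul (Q z z') - fsubst add (Q z z'))
  + (bivector_bracket (product_bivector Q) (mul z - add z) (mul z')
     + bivector_bracket (product_bivector Q) (add z) (mul z' - add z'))).
  apply: vanishesD; first exact/vanishesN/(fsubst_lead mul0E mul_lead)/Qk.
  by apply: vanishesD; apply: vanishes_bivector => //;
    [left|right]; apply: mul_lead.
have BN (f g : fps K (I + I)%type) :
    bivector_bracket (product_bivector Q) (- f) g =
    - bivector_bracket (product_bivector Q) f g.
  by apply/eqP; rewrite -addr_eq0 -bivectorDl addNr bivector0l.
have BN' (f g : fps K (I + I)%type) :
    bivector_bracket (product_bivector Q) g (- f) =
    - bivector_bracket (product_bivector Q) g f.
  by apply/eqP; rewrite -addr_eq0 -bivectorDr addNr bivector0r.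
by rewrite Qmul (bivectorDl _ (mul z)) (bivectorDr _ _ (mul z')) BN BN'; ring.
Qed.

(** The lowest homogeneous part q of Q satisfies q(x + y) = q(x) + q(y).
    Differentiating in x_i and setting x = 0 shows that every partial derivative
    of q is constant; the constants are coefficients of the linear part of Q,
    which is zero, and in characteristic zero q vanishes with its partial
    derivatives. *)
Lemma multiplicative_eq0 z z' : Q z z' = 0.
Proof.
apply: vanishes_eq0 => k; elim: k z z' => [|k IH] z z'; first exact: vanishes0.
have lead := multiplicative_lead IH z z'.
(* Apply d / d x_i and then restrict to x = 0. *)
have dQ i : vanishes k (fder i (Q z z')).
  have := vanishes_fder (inl i) lead.
  have dadd (f : fps K I) : fder (inl i) (fsubst add f) = fsubst add (fder i f).
    rewrite fder_fsubst; last exact: add0E.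
    rewrite (bigD1 i) //= linearD /= !fder_fvar eqxx addr0 mulr1 big1 ?addr0 //.
    move=> j ji; rewrite linearD /= !fder_fvar /= addr0.
    by rewrite -[_ == _]/(i == j) eq_sym (negbTE ji) mulr0.
  have dinl (f : fps K I) : fder (inl i) (fren (@inl I I) f) = fren inl (fder i f).
    rewrite fder_fren (bigD1 i) //= eqxx mulr1 big1 ?addr0 // => j ji.
    by rewrite -[_ == _]/(i == j) eq_sym (negbTE ji) mulr0.
  have dinr (f : fps K I) : fder (inl i) (fren (@inr I I) f) = 0.
    by rewrite fder_fren big1 // => j _; rewrite mulr0.
  rewrite linearB linearD /= dadd dinl dinr addr0 => /(vanishes_fsubst second0E).
  by rewrite linearB /= fsubst_second_add fsubst_second_inl fder0E Qlin scale0r subr0.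
(* In degree 0 the equation reads Q(0) = Q(0) + Q(0). *)
move=> d dk; have [/eqP d0|d0] := posnP (edeg d).
  move: d0; rewrite edeg_eq0 => /eqP ->; have := lead 0.
  rewrite edeg0 fpsDE fpsNE fpsDE fsubst0E ?fren0E; last exact: add0E.
  by move=> /(_ isT)/eqP; rewrite opprD addrA subrr sub0r oppr_eq0 => /eqP.
have [i /expo_pred [d' dE]] : exists i, (0 < d i)%N.
  exact: edeg_gt0.
have : fder i (Q z z') d' = 0.
  by apply: dQ; move: dk; rewrite dE edegD edeg_evar addn1.
by rewrite /fder -dE => /eqP; rewrite mulrn_eq0 => /eqP.
Qed.

End Uniqueness.

(** * Leading terms of the group multiplication *)

Section LeadingTerms.
Variables (K : fieldType) (m n : nat).
Variables (gam : 'I_n -> 'I_n -> 'I_n -> K) (alph : 'I_n -> 'I_m -> 'I_m -> K).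

Lemma campbell_hausdorff_deg N (d : expo ('I_n + 'I_n)%type) mu : edeg d = N ->
  campbell_hausdorff gam mu d =
  \sum_(w : N.-tuple bool) ch_coef K w / N%:R * ch_word gam w mu d.
Proof. by move=> <-. Qed.

Lemma ch_coef1 b : ch_coef K [:: b] = 1.
Proof.
rewrite /ch_coef /ncs_log big_nat1 /= /ncs_mul /ncs_exp /ncs_one.
rewrite !big_ord_recl !big_ord0 /=.
case: b; rewrite /= !factS !fact0 !muln1 expr0 !invr1; ring.
Qed.

(** Only the two words of length one contribute in degree one. *)
Lemma campbell_hausdorff_lead mu :
  vanishes 2 (campbell_hausdorff gam mu - (fvar K (inl mu) + fvar K (inr mu))).
Proof.
apply: vanishes2 => [|t]; rewrite fpsDE fpsNE fpsDE.
  rewrite (@campbell_hausdorff_deg 0) ?edeg0 // big1 => [|w _].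
    by rewrite !fvar0E addr0 subrr.
  by rewrite tuple0 /= mulr0.
rewrite (@campbell_hausdorff_deg 1) ?edeg_evar //.
rewrite (reindex (fun b : bool => [tuple b])) /=; last first.
  exists (fun w : 1.-tuple bool => thead w) => // w _.
  by apply/val_inj; case/tupleP: w => b w; rewrite (tuple0 w).
rewrite big_bool /= !ch_coef1 divr1 !mul1r /ch_letter.
by apply/eqP; rewrite subr_eq0 addrC.
Qed.

Lemma exp_alpha0E i k : exp_alpha alph i k 0 = (i == k)%:R.
Proof.
rewrite /exp_alpha /fexpmx mxE edeg0 big_ord1 expr0 fact0 invr1 mul1r.
by rewrite mxE; case: eqP => _ /=; rewrite ?mulr1n ?mulr0n ?fps1E ?eqxx ?fps0E.
Qed.

Lemma gmult_lead z :
  vanishes 2 (gmult gam alph z - (fvar K (inl z) + fvar K (inr z))).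
Proof.
case: z => [i|mu] /=; last first.
  set r := fun t => _.
  rewrite (_ : _ - _ = fren r (campbell_hausdorff gam mu
      - (fvar K (inl mu) + fvar K (inr mu)))).
    by apply: vanishes_fsubst (campbell_hausdorff_lead mu) => t; apply: fvar0E.
  rewrite linearB /= [fren r (_ + fvar _ _)]linearD /= !fren_fvar. by [].
rewrite /gH fren_fvar opprD addrA addrK.
rewrite (_ : _ - _ = \sum_k
   fren inl (gser (exp_alpha alph i k - (i == k)%:R)) * fvar K (inr (inl k))).
  apply: vanishes_sum => k _; apply: (@vanishesM _ _ 1 1); last exact: vanishes_fvar.
  apply: vanishes1; rewrite fren0E /gser fren0E fpsDE fpsNE exp_alpha0E.
  by case: eqP => _ /=; rewrite ?mulr1n ?mulr0n ?fps1E ?eqxx ?fps0E subrr.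
under [RHS]eq_bigr => k _ do rewrite /gser linearB /= linearB /= mulrBl.
rewrite sumrB; congr (_ - _).
  by apply: eq_bigr => k _; rewrite fren_fvar.
rewrite (bigD1 i) //= eqxx /gser !rmorph1 mul1r big1 ?addr0 // => k ki.
by rewrite eq_sym (negbTE ki) !rmorph0 mul0r.
Qed.

End LeadingTerms.

(** * Consequences of the coproduct being a morphism of algebras *)

Section Commutators.
Variables (R : pzRingType).
Implicit Types x y z : R.

Definition com x y := x * y - y * x.

Lemma comDl x y z : com (x + y) z = com x z + com y z.
Proof. by rewrite /com mulrDl mulrDr opprD addrACA. Qed.

Lemma comDr x y z : com z (x + y) = com z x + com z y.
Proof. by rewrite /com mulrDl mulrDr opprD addrACA. Qed.

Lemma comN x y : com x y = - com y x.
Proof. by rewrite /com opprB. Qed.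

Lemma com_suml (J : Type) (r : seq J) (F : J -> R) y :
  com (\sum_(j <- r) F j) y = \sum_(j <- r) com (F j) y.
Proof. by rewrite /com mulr_suml mulr_sumr sumrB. Qed.

Lemma com_sumr (J : Type) (r : seq J) (F : J -> R) y :
  com y (\sum_(j <- r) F j) = \sum_(j <- r) com y (F j).
Proof. by rewrite /com mulr_suml mulr_sumr sumrB. Qed.

Lemma comMr x y z : com x (y * z) = com x y * z + y * com x z.
Proof. by rewrite /com mulrBl mulrBr !mulrA addrA subrK. Qed.

Lemma comMl x y z : com (x * y) z = x * com y z + com x z * y.
Proof. by rewrite /com mulrBl mulrBr !mulrA addrA subrK. Qed.

End Commutators.

Section QuantumIdentities.
Variables (K : fieldType) (m n : nat).
Variables (C : 'I_m -> 'I_m -> 'I_m -> K) (A : 'I_m -> 'I_n -> 'I_n -> K).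
Variables (gam : 'I_n -> 'I_n -> 'I_n -> K) (alph : 'I_n -> 'I_m -> 'I_m -> K).
Variable U : quantum_algebra C A gam alph.

Local Notation W := (uq2 U).
Local Notation J := ('I_2 * 'I_n)%type.
Local Notation iota := (cp_ser W).
Local Notation slot a := (fun mu : 'I_n => (a, mu) : J).

Definition hslot (a : 'I_2) (i : 'I_m) : W := cp_in W a (uq_h U i).

Definition exp_slot (i k : 'I_m) : fps K J := fren (slot ord0) (exp_alpha alph i k).

Definition ch_slots (mu : 'I_n) : fps K J :=
  fren (fun z => match z with
                 | inl nu => (ord0, nu)
                 | inr nu => (ord_max, nu)
                 end) (campbell_hausdorff gam mu).

(** The vector field on pairs of points defined by commutation with the copy of
    the i-th generator in the factor a. *)
Definition hfield (a : 'I_2) (i : 'I_m) (f : fps K J) : fps K J :=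
  \sum_s fder s f *
    (if s.1 == a then fren (slot a) (uq_A U i s.2) else 0).

Lemma hmon0 (h : 'I_m -> U) : hmon h 0 = 1.
Proof. by rewrite /hmon big1 // => i _; rewrite ffunE. Qed.

Lemma hmon_evar (h : 'I_m -> U) l : hmon h (evar l) = h l.
Proof.
transitivity (\prod_(i < m | i == l) h i); last exact: big_pred1_eq.
rewrite /hmon [RHS]big_mkcond; apply: eq_bigr => i _; rewrite evarE /=.
by case: eqP => [->|]; rewrite ?expr1.
Qed.

Let e (t : 'I_2 * 'I_m) : {ffun 'I_2 -> expo 'I_m} :=
  [ffun b => if b == t.1 then evar t.2 else 0].

Let e_inj : injective e.
Proof.
move=> [a i] [a' i'] /ffunP E; have := E a; have := E a'; rewrite !ffunE /= !eqxx.
have evar_neq0 l : evar l <> 0 :> expo 'I_m.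
  by move/ffunP => /(_ l); rewrite evarE eqxx ffunE.
case: eqP => [-> _|_ /esym /evar_neq0 //].
by rewrite eqxx => /evar_inj ->.
Qed.

Let eE t : \prod_(b < 2) cp_in W b (hmon (uq_h U) (e t b)) = hslot t.1 t.2.
Proof.
transitivity (\prod_(b < 2 | b == t.1) cp_in W b (uq_h U t.2));
  last exact: big_pred1_eq.
rewrite [RHS]big_mkcond; apply: eq_bigr => b _; rewrite ffunE /=.
by case: eqP => _; rewrite ?hmon0 ?rmorph1 ?hmon_evar.
Qed.

Lemma square_separated : series_separated iota.
Proof. exact: series_basis_separated (cp_basis W). Qed.

Lemma square_inj : injective iota.
Proof.
apply: (series_basis_inj (cp_basis W) (e := [ffun=> 0])).
by rewrite big1 // => b _; rewrite ffunE hmon0 rmorph1.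
Qed.

Lemma hslot_free (u v : 'I_m -> fps K J) :
  \sum_l iota (u l) * hslot ord0 l + \sum_l iota (v l) * hslot ord_max l = 0 ->
  forall l, u l = 0 /\ v l = 0.
Proof.
move=> uv0.
have := series_basis_free (cp_basis W) (e := e)
  (u := fun t => if t.1 == ord0 then u t.2 else v t.2) e_inj.
under eq_bigr => t _ do rewrite eE.
rewrite -(pair_bigA _ (fun a l => iota (if a == ord0 then u l else v l) * hslot a l)).
rewrite /= !big_ord_recl big_ord0 /= addr0.
have -> : lift ord0 ord0 = ord_max :> 'I_2 by apply/val_inj.
move=> /(_ uv0) h l; split; [exact: (h (ord0, l))|exact: (h (ord_max, l))].
Qed.

Lemma hslot_com_other a b i (f : fps K 'I_n) : a != b ->
  com (hslot a i) (iota (fren (slot b) f)) = 0.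
Proof. by move=> ab; rewrite -cp_inE /com /hslot cp_comm // subrr. Qed.

Lemma series_com (f h : fps K J) : com (iota f) (iota h) = 0.
Proof. by rewrite /com -!rmorphM mulrC subrr. Qed.

(** The commutator is a derivation of the series with values in the completed
    square, which is Hausdorff; the defining relations give its values on the
    variables. *)
Lemma hslot_com_series a i f : com (hslot a i) (iota f) = iota (hfield a i f).
Proof.
apply: (derivation_fps (iota := iota) (D := fun f => com (hslot a i) (iota f))
  (a := fun s => if s.1 == a then fren (slot a) (uq_A U i s.2) else 0)).
- exact: square_separated.
- move=> c u v; rewrite linearP comDr; congr (_ + _).
  by rewrite /com -scalerAl -scalerAr scalerBr.
- by move=> u v; rewrite rmorphM comMr.
- move=> [b nu] /=.
  have -> : fvar K (b, nu) = fren (slot b) (fvar K nu) by rewrite fren_fvar.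
  have [->|ba] := eqVneq b a; last by rewrite hslot_com_other ?rmorph0 // eq_sym.
  by rewrite -!cp_inE -uq_hx rmorphB !rmorphM.
Qed.

(** Generators of different factors commute. *)
Lemma hfield_other a b i f : a != b -> hfield a i (fren (slot b) f) = 0.
Proof.
by move=> ab; apply: square_inj; rewrite -hslot_com_series hslot_com_other // rmorph0.
Qed.

Lemma hslot_com_slots i k : com (hslot ord_max i) (hslot ord0 k) = 0.
Proof. by rewrite /com /hslot cp_comm // subrr. Qed.

Lemma hslot_com a i k : com (hslot a i) (hslot a k) =
  \sum_l iota (fren (slot a) (uq_C U i k l)) * hslot a l.
Proof.
rewrite /com /hslot -!rmorphM -rmorphB uq_hh rmorph_sum.
by apply: eq_bigr => l _; rewrite rmorphM /= cp_inE.
Qed.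

Lemma DeltaH i : uq_Delta U (uq_h U i) =
  \sum_k iota (exp_slot i k) * hslot ord_max k + hslot ord0 i.
Proof.
rewrite uq_DeltaH; congr (_ + _).
by apply: eq_bigr => k _; rewrite cp_inE.
Qed.

Lemma ch_slots0 mu : ch_slots mu 0 = 0.
Proof.
rewrite /ch_slots fren0E; exact: lead0 (@campbell_hausdorff_lead _ _ gam mu).
Qed.

(** Both sides are morphisms of algebras in f that agree on the variables. *)
Lemma Delta_ser f : uq_Delta U (uq_ser U f) = iota (fsubst ch_slots f).
Proof.
apply: (fps_rigid (iota := iota) (g := ch_slots)
  (F := fun f => uq_Delta U (uq_ser U f)) (G := fun f => iota (fsubst ch_slots f))).
- exact: square_separated.
- exact: ch_slots0.
- by move=> c u v; rewrite !linearP.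
- by move=> c u v; rewrite !linearP.
- by rewrite fsubst1 !rmorph1.
- move=> mu u; rewrite fsubst_fvarM; last exact: ch_slots0.
  by rewrite !rmorphM /= uq_DeltaX mulrBr.
Qed.

(** The coproduct of [H_i, X^mu] = A_i^mu(X). *)
Lemma quantum_hx i mu : fsubst ch_slots (uq_A U i mu) =
  \sum_k exp_slot i k * hfield ord_max k (ch_slots mu)
  + hfield ord0 i (ch_slots mu).
Proof.
apply: square_inj; rewrite -Delta_ser -uq_hx rmorphB !rmorphM /= DeltaH.
rewrite Delta_ser fsubst_fvar; last exact: ch_slots0.
rewrite -/(com _ _) comDl com_suml rmorphD hslot_com_series; congr (_ + _).
rewrite rmorph_sum /=; apply: eq_bigr => k _; rewrite comMl hslot_com_series rmorphM /=.
by rewrite series_com mul0r addr0.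
Qed.

(** The coefficient of 1 (x) H_r in the commutator of the coproducts of H_i and
    H_k. *)
Definition hh_coef i k r : fps K J :=
  \sum_p \sum_q exp_slot i p * exp_slot k q * fren (slot ord_max) (uq_C U p q r)
  - hfield ord0 k (exp_slot i r) + hfield ord0 i (exp_slot k r).

(** The coproduct of [H_i, H_k] = C_ik^l(X) H_l, read off on the generators of
    the two factors. *)
Lemma quantum_hh i k :
  (forall l, fsubst ch_slots (uq_C U i k l) = fren (slot ord0) (uq_C U i k l)) /\
  forall r, \sum_l fsubst ch_slots (uq_C U i k l) * exp_slot l r = hh_coef i k r.
Proof.
pose a j := \sum_p iota (exp_slot j p) * hslot ord_max p.
have expC p j q : com (hslot ord_max p) (iota (exp_slot j q)) = 0.
  exact: hslot_com_other.
have aa : com (a i) (a k) = \sum_r iota (\sum_p \sum_q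
    exp_slot i p * exp_slot k q * fren (slot ord_max) (uq_C U p q r))
    * hslot ord_max r.
  rewrite com_suml.
  under [RHS]eq_bigr => r _ do rewrite rmorph_sum mulr_suml.
  rewrite exchange_big; apply: eq_bigr => p _; rewrite com_sumr.
  under [RHS]eq_bigr => r _ do rewrite rmorph_sum mulr_suml.
  rewrite exchange_big; apply: eq_bigr => q _ /=.
  rewrite comMl !comMr series_com expC [com (iota _) (hslot _ _)]comN expC.
  rewrite oppr0 !(mulr0, mul0r, addr0, add0r) hslot_com !mulr_sumr.
  apply: eq_bigr => r _.
  by rewrite (rmorphM iota) (rmorphM iota) /= -!mulrA.
have ba j l : com (hslot ord0 j) (a l) =
    \sum_r iota (hfield ord0 j (exp_slot l r)) * hslot ord_max r.
  rewrite com_sumr; apply: eq_bigr => r _.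
  by rewrite comMr hslot_com_series [com (hslot ord0 _) (hslot _ _)]comN hslot_com_slots
    oppr0 mulr0 addr0.
have split1 (u v : 'I_m -> fps K J) b :
    \sum_r iota (u r - v r) * hslot b r =
    \sum_r iota (u r) * hslot b r - \sum_r iota (v r) * hslot b r.
  by rewrite -sumrB; apply: eq_bigr => r _; rewrite (rmorphB iota) mulrBl.
have lhs : com (uq_Delta U (uq_h U i)) (uq_Delta U (uq_h U k)) =
    \sum_l iota (fren (slot ord0) (uq_C U i k l)) * hslot ord0 l
    + \sum_r iota (hh_coef i k r) * hslot ord_max r.
  rewrite !DeltaH -!/(a _) comDl !comDr aa ba (comN (a i)) ba hslot_com.
  rewrite [RHS]addrC addrA; congr (_ + _).
  rewrite -sumrN -!big_split; apply: eq_bigr => r _ /=.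
  by rewrite -!mulNr -!mulrDl -(rmorphN iota) -!(rmorphD iota).
have rhs : \sum_l uq_Delta U (uq_ser U (uq_C U i k l) * uq_h U l) =
    \sum_l iota (fsubst ch_slots (uq_C U i k l)) * hslot ord0 l
    + \sum_r iota (\sum_l fsubst ch_slots (uq_C U i k l) * exp_slot l r)
      * hslot ord_max r.
  under [X in _ = _ + X]eq_bigr => r _ do rewrite rmorph_sum mulr_suml.
  rewrite exchange_big -big_split; apply: eq_bigr => l _ /=.
  rewrite (rmorphM (uq_Delta U)) /= Delta_ser DeltaH mulrDr addrC mulr_sumr.
  congr (_ + _); apply: eq_bigr => r _.
  by rewrite (rmorphM iota) mulrA.
have E : com (uq_Delta U (uq_h U i)) (uq_Delta U (uq_h U k)) =
    \sum_l uq_Delta U (uq_ser U (uq_C U i k l) * uq_h U l).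
  by rewrite -(rmorph_sum (uq_Delta U)) -uq_hh (rmorphB (uq_Delta U))
    !(rmorphM (uq_Delta U)).
have h := @hslot_free
  (fun l => fren (slot ord0) (uq_C U i k l) - fsubst ch_slots (uq_C U i k l))
  (fun r => hh_coef i k r - \sum_l fsubst ch_slots (uq_C U i k l) * exp_slot l r).
split=> r; have [|h0 h1] := h _ r.
- by rewrite !split1 addrACA -lhs -opprD -rhs E subrr.
- by apply/esym/eqP; rewrite -subr_eq0 h0.
- by rewrite !split1 addrACA -lhs -opprD -rhs E subrr.
- by apply/esym/eqP; rewrite -subr_eq0 h1.
Qed.

End QuantumIdentities.

(** * The bivector field given by the commutation relations *)

Section QuantumBivector.
Variables (K : fieldType) (m n : nat).
Variables (C : 'I_m -> 'I_m -> 'I_m -> K) (A : 'I_m -> 'I_n -> 'I_n -> K).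
Variables (gam : 'I_n -> 'I_n -> 'I_n -> K) (alph : 'I_n -> 'I_m -> 'I_m -> K).
Variable U : quantum_algebra C A gam alph.

Local Notation gvar := (gvar m n).
Local Notation J := ('I_2 * 'I_n)%type.
Local Notation slot a := (fun mu : 'I_n => (a, mu) : J).

Definition quantum_bivector (z z' : gvar) : gfun K m n :=
  match z, z' with
  | inl i, inl k => \sum_l gser (uq_C U i k l) * gH l
  | inl i, inr mu => gser (uq_A U i mu)
  | inr mu, inl i => - gser (uq_A U i mu)
  | inr _, inr _ => 0
  end.

Local Notation B := (bivector_bracket (product_bivector quantum_bivector)).

(** Variables of the two factors, indexed as in the tensor square. *)
Definition side (a : 'I_2) (z : gvar) : gvar + gvar :=
  if a == ord0 then inl z else inr z.

Definition xside (s : J) : gvar + gvar := side s.1 (inr s.2).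

Local Notation R f := (fren xside f).

Definition gHside a i : fps K (gvar + gvar)%type := fvar K (side a (inl i)).

Lemma product_bivector_side (P : gvar -> gvar -> gfun K m n) a b z z' :
  product_bivector P (side a z) (side b z') =
  if a == b then fren (side a) (P z z') else 0.
Proof.
have side0 : side ord0 = inl by [].
have side1 : side ord_max = inr by [].
have two (c : 'I_2) : c = ord0 \/ c = ord_max.
  by case: c => [[|[|c]] hc] //; [left|right]; apply/val_inj.
by case: (two a) => ->; case: (two b) => ->; rewrite ?side0 ?side1.
Qed.

Lemma fder_xside t (f : fps K J) :
  fder t (R f) = \sum_s R (fder s f) * (t == xside s)%:R.
Proof. exact: fder_fren. Qed.

Lemma bivector_xside P (G : fps K (gvar + gvar)%type) (f : fps K J) :
  bivector_bracket P G (R f) =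
  \sum_s R (fder s f) * \sum_t fder t G * P t (xside s).
Proof.
under [RHS]eq_bigr => s _ do rewrite mulr_sumr.
rewrite exchange_big; apply: eq_bigr => t _ /=.
under eq_bigr => t' _ do rewrite fder_xside mulr_sumr mulr_suml.
rewrite exchange_big; apply: eq_bigr => s _ /=.
rewrite (bigD1 (xside s)) //= eqxx mulr1 big1 ?addr0 => [|t' /negbTE ->]; first by ring.
by rewrite mulr0 mulr0 mul0r.
Qed.

(** A series in the X variables only meets the components of the bivector field
    with an X index, which are antisymmetric by definition. *)
Lemma quantum_bivector_anti f G : B (R f) G = - B G (R f).
Proof.
have inv s t : product_bivector quantum_bivector (xside s) t =
    - product_bivector quantum_bivector t (xside s).
  have [a [z ->]] : exists a z, t = side a z.
    by case: t => z; [exists ord0|exists ord_max]; exists z.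
  rewrite !product_bivector_side eq_sym; case: eqP => [->|]; last by rewrite oppr0.
  by case: z => [i|nu] /=; rewrite ?raddfN ?raddf0 ?oppr0.
rewrite bivector_xside -sumrN.
transitivity (\sum_t \sum_s
  fder t (R f) * fder s G * product_bivector quantum_bivector t s) => //.
under eq_bigr => t _.
  under eq_bigr => s _ do rewrite fder_xside !mulr_suml.
  rewrite exchange_big /=; over.
rewrite exchange_big; apply: eq_bigr => s _ /=.
rewrite (bigD1 (xside s)) //= [X in _ + X]big1 ?addr0 => [|t /negbTE ->]; last first.
  by rewrite big1 // => t' _; rewrite mulr0 !mul0r.
rewrite eqxx mulr1 -mulrN -sumrN mulr_sumr; apply: eq_bigr => t _.
by rewrite inv; ring.
Qed.

Lemma bracket_series f f' : B (R f) (R f') = 0.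
Proof.
rewrite bivector_xside big1 // => s _; rewrite big1 ?mulr0 // => t _.
rewrite fder_xside mulr_suml big1 // => s' _.
case: eqP => [->|]; last by rewrite mulr0 mul0r.
by rewrite product_bivector_side /=; case: eqP => _; rewrite ?raddf0 mulr0.
Qed.

Lemma bracket_h_series a i f : B (gHside a i) (R f) = R (hfield U a i f).
Proof.
rewrite bivector_xside rmorph_sum; apply: eq_bigr => s _.
rewrite rmorphM /= (bigD1 (side a (inl i))) //= fder_fvar eqxx mul1r.
rewrite big1 ?addr0 => [|t /negbTE ti]; last by rewrite fder_fvar ti mul0r.
rewrite product_bivector_side eq_sym; case: eqP => [<-|]; last by rewrite rmorph0.
by rewrite /= /gser !fren_comp.
Qed.

Lemma bracket_h_h a b i k : B (gHside a i) (gHside b k) =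
  if a == b then \sum_l R (fren (slot a) (uq_C U i k l)) * gHside a l else 0.
Proof.
rewrite bivector_var product_bivector_side; case: eqP => // _ /=.
rewrite rmorph_sum; apply: eq_bigr => l _.
by rewrite rmorphM /= /gser fren_fvar !fren_comp.
Qed.

Local Notation mul := (gmult gam alph).

Lemma gmult0 z : mul z 0 = 0.
Proof. exact: lead0 (@gmult_lead _ _ _ gam alph z). Qed.

Lemma gmultX mu : mul (inr mu) = R (ch_slots gam mu).
Proof.
rewrite /= /ch_slots fren_comp; congr (fren _ _).
by apply/funext => -[].
Qed.

Lemma gmultH i : mul (inl i) =
  \sum_k R (exp_slot alph i k) * gHside ord_max k + gHside ord0 i.
Proof.
rewrite /= /gH !fren_fvar; congr (_ + _).
by apply: eq_bigr => k _; rewrite fren_fvar /exp_slot /gser !fren_comp.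
Qed.

Lemma gDelta_ser f : fsubst mul (gser f) = R (fsubst (ch_slots gam) f).
Proof.
move: f; apply: (fps_rigid_fps (g := fun mu => R (ch_slots gam mu))
  (F := fun f => fsubst mul (gser f)) (G := fun f => R (fsubst (ch_slots gam) f))).
- by move=> mu; rewrite fren0E ch_slots0.
- by move=> c u v; rewrite /gser !linearP.
- by move=> c u v; rewrite !linearP.
- by rewrite /gser rmorph1 !fsubst1 rmorph1.
- move=> mu u; rewrite /gser rmorphM /= fsubstM; last exact: gmult0.
  rewrite fren_fvar fsubst_fvar ?gmultX; last exact: gmult0.
  rewrite fsubst_fvarM; last exact: ch_slots0.
  by rewrite rmorphM mulrBr.
Qed.

End QuantumBivector.

Section QuantumMultiplicative.
Variables (K : fieldType) (m n : nat).
Variables (C : 'I_m -> 'I_m -> 'I_m -> K) (A : 'I_m -> 'I_n -> 'I_n -> K).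
Variables (gam : 'I_n -> 'I_n -> 'I_n -> K) (alph : 'I_n -> 'I_m -> 'I_m -> K).
Variable U : quantum_algebra C A gam alph.

Local Notation slot a := (fun mu : 'I_n => (a, mu) : 'I_2 * 'I_n).
Local Notation B := (bivector_bracket (product_bivector (quantum_bivector U))).
Local Notation R f := (fren (@xside m n) f).
Local Notation mul := (gmult gam alph).
Local Notation Hs := (@gHside K m n).

Lemma multiplicative_hx i mu : B (mul (inl i)) (mul (inr mu)) =
  fsubst mul (gser (uq_A U i mu)).
Proof.
rewrite gDelta_ser quantum_hx gmultH gmultX bivectorDl bivector_suml.
rewrite rmorphD bracket_h_series; congr (_ + _); rewrite rmorph_sum.
apply: eq_bigr => k _ /=.
by rewrite bivectorMl bracket_series mul0r add0r bracket_h_series rmorphM.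
Qed.

(** Term by term the same computation as that of the commutator of the
    coproducts of H_i and H_k. *)
Lemma multiplicative_hh i k : B (mul (inl i)) (mul (inl k)) =
  \sum_l R (fren (slot ord0) (uq_C U i k l)) * Hs ord0 l
  + \sum_r R (hh_coef U i k r) * Hs ord_max r.
Proof.
pose a j := \sum_p R (exp_slot alph j p) * Hs ord_max p.
have expC p j q : B (Hs ord_max p) (R (exp_slot alph j q)) = 0.
  by rewrite bracket_h_series hfield_other // rmorph0.
have expC' p j q : B (R (exp_slot alph j q)) (Hs ord_max p) = 0.
  by rewrite quantum_bivector_anti expC oppr0.
have aa : B (a i) (a k) = \sum_r R (\sum_p \sum_q
    exp_slot alph i p * exp_slot alph k q * fren (slot ord_max) (uq_C U p q r))
    * Hs ord_max r.
  rewrite bivector_suml.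
  under [RHS]eq_bigr => r _ do rewrite rmorph_sum mulr_suml.
  rewrite [RHS]exchange_big; apply: eq_bigr => p _; rewrite bivector_sumr.
  under [RHS]eq_bigr => r _ do rewrite rmorph_sum mulr_suml.
  rewrite [RHS]exchange_big; apply: eq_bigr => q _ /=.
  rewrite bivectorMl !bivectorMr bracket_series expC expC'.
  rewrite !(mulr0, mul0r, addr0, add0r) bracket_h_h eqxx !mulr_sumr.
  apply: eq_bigr => r _.
  by rewrite [in RHS]rmorphM /= [in RHS]rmorphM /= -!mulrA.
have ba j l : B (Hs ord0 j) (a l) =
    \sum_r R (hfield U ord0 j (exp_slot alph l r)) * Hs ord_max r.
  rewrite bivector_sumr; apply: eq_bigr => r _.
  by rewrite bivectorMr bracket_h_series bracket_h_h /= mulr0 addr0.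
have ab j l : B (a l) (Hs ord0 j) = - B (Hs ord0 j) (a l).
  rewrite ba bivector_suml -sumrN; apply: eq_bigr => r _.
  rewrite bivectorMl quantum_bivector_anti bracket_h_series bracket_h_h /= mulr0 addr0.
  by rewrite mulNr.
have mulE j : mul (inl j) = a j + Hs ord0 j by rewrite gmultH.
have bb : B (Hs ord0 i) (Hs ord0 k) =
    \sum_l R (fren (slot ord0) (uq_C U i k l)) * Hs ord0 l.
  by rewrite bracket_h_h eqxx.
rewrite !mulE; move: (Hs ord0) a mulE {expC expC'} aa ab ba bb => b a _ aa ab ba bb.
rewrite bivectorDl !bivectorDr aa ab !ba bb.
rewrite [RHS]addrC addrA; congr (_ + _).
rewrite -sumrN -!big_split; apply: eq_bigr => r _ /=.
by rewrite /hh_coef rmorphD rmorphB /=; ring.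
Qed.

(** The identities between series on the tensor square, carried over to pairs of
    points of the group by renaming variables, are the components of
    multiplicativity. *)
Lemma quantum_multiplicative z z' :
  fsubst mul (quantum_bivector U z z') = B (mul z) (mul z').
Proof.
case: z z' => [i|mu] [k|nu]; last first.
- by rewrite !gmultX bracket_series linear0.
- by rewrite gmultX quantum_bivector_anti -(gmultX gam alph) multiplicative_hx linearN.
- by rewrite multiplicative_hx.
have g0 := @gmult0 K m n gam alph.
rewrite multiplicative_hh /= linear_sum.
under [X in _ = _ + X]eq_bigr => r _ do
  rewrite -(quantum_hh U i k).2 rmorph_sum mulr_suml.
rewrite exchange_big -big_split; apply: eq_bigr => l _ /=.
rewrite (fsubstM g0) (fsubst_fvar g0) gDelta_ser (quantum_hh U i k).1 gmultH.
rewrite mulrDr addrC mulr_sumr; congr (_ + _); apply: eq_bigr => r _.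
by rewrite rmorphM /= -(quantum_hh U i k).1 mulrA.
Qed.

End QuantumMultiplicative.

(** * Linear parts *)

Section LinearParts.
Variables (K : numFieldType) (L : vectType K) (B : catB L) (m n : nat).
Variables (H : m.-tuple L) (X : n.-tuple L).
Variables (C : 'I_m -> 'I_m -> 'I_m -> K) (A : 'I_m -> 'I_n -> 'I_n -> K).
Variables (gam : 'I_n -> 'I_n -> 'I_n -> K) (alph : 'I_n -> 'I_m -> 'I_m -> K).
Hypothesis hsc : structure_constants B H X C A gam alph.

Lemma sgH i : sg B (tnth H i) = - tnth H i.
Proof.
have := basis_mem (sc_H hsc) (mem_tnth i H).
rewrite memv_ker => /eqP; rewrite !lfunE /= !lfunE /= !lfunE /= id_lfunE.
by rewrite scaleN1r opprK => /eqP; rewrite addr_eq0 => /eqP.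
Qed.

Lemma sgX mu : sg B (tnth X mu) = tnth X mu.
Proof. exact/fixedSpaceP/(basis_mem (sc_X hsc))/mem_tnth. Qed.

Lemma double_eq0 (v : L) : v + v = 0 -> v = 0.
Proof.
by rewrite -mulr2n -scaler_nat => /eqP; rewrite scaler_eq0 pnatr_eq0 => /eqP.
Qed.

(** On the invariant subspace the involution is at once multiplicative and
    anti-multiplicative. *)
Lemma bracket_XX mu nu : lb B (tnth X mu) (tnth X nu) = 0.
Proof.
have anti := lie_bracket_anti (lb_lie B).
have := sg_anti B (tnth X mu) (tnth X nu).
rewrite sg_inv_sub ?sgX // anti => /eqP; rewrite eq_sym -addr_eq0 => /eqP.
by move/double_eq0 => ->; rewrite oppr0.
Qed.

Lemma eigenbasis_free (a : 'I_m -> K) (b : 'I_n -> K) :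
  \sum_i a i *: tnth H i + \sum_mu b mu *: tnth X mu = 0 ->
  (forall i, a i = 0) /\ (forall mu, b mu = 0).
Proof.
move=> ab; have := congr1 (sg B) ab; rewrite linear0 linearD !linear_sum /=.
under eq_bigr => i _ do rewrite linearZ /= sgH scalerN.
under [X in _ + X]eq_bigr => mu _ do rewrite linearZ /= sgX.
rewrite sumrN => /eqP; rewrite addrC subr_eq0 => /eqP XH.
have H0 : \sum_i a i *: tnth H i = 0 by apply: double_eq0; rewrite -{2}XH.
split.
  move/freeP: (basis_free (sc_H hsc)) => /(_ a); apply; rewrite -[RHS]H0.
  by apply: eq_bigr => i _; rewrite (tnth_nth 0).
move/freeP: (basis_free (sc_X hsc)) => /(_ b); apply; rewrite -[RHS]H0 -[RHS]XH.
by apply: eq_bigr => i _; rewrite (tnth_nth 0).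
Qed.

Lemma gdiff_inj (f g : gfun K m n) :
  gdiff H X f = gdiff H X g -> forall z, f (evar z) = g (evar z).
Proof.
move=> /eqP; rewrite -subr_eq0 opprD addrACA -!sumrB => /eqP fg.
have [|h0 h1] := @eigenbasis_free
  (fun i => f (evar (inl i)) - g (evar (inl i)))
  (fun mu => f (evar (inr mu)) - g (evar (inr mu))).
  rewrite -[RHS]fg; congr (_ + _); apply: eq_bigr => i _; exact: scalerBl.
by case=> [i|mu]; apply/eqP; rewrite -subr_eq0 ?h0 ?h1.
Qed.

Lemma gdiffH i : gdiff H X (gH i) = tnth H i.
Proof.
rewrite /gdiff /gH (bigD1 i) //= fvar_evar eqxx scale1r !big1 ?addr0 //.
  by move=> mu _; rewrite fvar_evar scale0r.
move=> l li; rewrite fvar_evar -[_ == _]/(l == i) (negbTE li) scale0r.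
by [].
Qed.

Lemma gdiffX mu : gdiff H X (gX mu) = tnth X mu.
Proof.
rewrite /gdiff /gX [X in _ + X](bigD1 mu) //= fvar_evar eqxx scale1r
  !big1 ?addr0 ?add0r //.
  by move=> nu ne; rewrite fvar_evar -[_ == _]/(nu == mu) (negbTE ne) scale0r.
by move=> i _; rewrite fvar_evar scale0r.
Qed.

Variable U : quantum_algebra C A gam alph.

Lemma gdiff_quantum_bivector z z' :
  gdiff H X (quantum_bivector U z z') =
  lb B (gdiff H X (fvar K z)) (gdiff H X (fvar K z')).
Proof.
have anti := lie_bracket_anti (lb_lie B).
have hx i mu : gdiff H X (gser (uq_A U i mu)) = lb B (tnth H i) (tnth X mu).
  rewrite (sc_A hsc) /gdiff big1 ?add0r => [|l _]; last first.
    by rewrite /gser fren_evar big1 ?scale0r // => nu _; rewrite mulr0n.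
  apply: eq_bigr => nu _; rewrite -(uq_A1 U) /gser fren_evar (bigD1 nu) //= eqxx.
  rewrite big1 ?addr0 // => nu' ne.
  by rewrite -[_ == _]/(nu == nu') eq_sym (negbTE ne).
case: z z' => [i|mu] [k|nu]; rewrite -?/(gH _) -?/(gX _) ?gdiffH ?gdiffX //=.
- have coef z : (\sum_l gser (uq_C U i k l) * gH l : gfun K m n) (evar z) =
      \sum_l C i k l *+ (z == inl l).
    rewrite fps_sumE; apply: eq_bigr => l _; rewrite fpsM_evar.
    rewrite /gH fvar0E mulr0 add0r /gser fren0E (uq_C0 U) fvar_evar.
    by case: eqP; rewrite ?mulr1 ?mulr0.
  rewrite (sc_C hsc) /gdiff [X in _ + X]big1 ?addr0 => [|mu _]; last first.
    by rewrite coef big1 ?scale0r // => l _; rewrite mulr0n.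
  apply: eq_bigr => l _; rewrite coef (bigD1 l) //= eqxx.
  rewrite big1 ?addr0 // => l' ne.
  by rewrite -[_ == _]/(l == l') eq_sym (negbTE ne).
- rewrite anti -hx /gdiff opprD -!sumrN.
  by congr (_ + _); apply: eq_bigr => j _; rewrite fpsNE scaleNr.
- by rewrite bracket_XX /gdiff !big1 ?addr0 // => j _; rewrite fps0E scale0r.
Qed.

End LinearParts.

Theorem mainTheorem6 (K : numFieldType) (L : vectType K) (B : catB L)
    (m n : nat) (H : m.-tuple L) (X : n.-tuple L)
    (C : 'I_m -> 'I_m -> 'I_m -> K) (A : 'I_m -> 'I_n -> 'I_n -> K)
    (gam : 'I_n -> 'I_n -> 'I_n -> K) (alph : 'I_n -> 'I_m -> 'I_m -> K)
    (hsc : structure_constants B H X C A gam alph)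
    (U : quantum_algebra C A gam alph)
    (br : gfun K m n -> gfun K m n -> gfun K m n)
    (hPL : poisson_lie gam alph br)
    (hlin : linearization H X br (fun x y => lb B x y)) :
  [/\ forall mu nu : 'I_n, br (gX mu) (gX nu) = 0,
      forall i k : 'I_m,
        br (gH i) (gH k) = \sum_l gser (uq_C U i k l) * gH l &
      forall (i : 'I_m) (mu : 'I_n),
        br (gH i) (gX mu) = gser (uq_A U i mu)].
Proof.
have [_ [br2 pb br2Delta]] := hPL.
pose P (z z' : gvar m n) := br (fvar K z) (fvar K z').
have Pmul z z' : fsubst (gmult gam alph) (P z z') =
    bivector_bracket (product_bivector P) (gmult gam alph z) (gmult gam alph z').
  rewrite -(product_bracketE pb) /P -[LHS]/(gDelta gam alph _) br2Delta.
  by rewrite /gDelta !(fsubst_fvar (@gmult0 _ _ _ gam alph)).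
(* Both bivector fields are multiplicative with the same linear part. *)
suff E z z' : P z z' = quantum_bivector U z z'.
  by split=> *; rewrite -[LHS]/(P _ _) E.
apply/eqP; rewrite -subr_eq0; apply/eqP.
apply: (multiplicative_eq0 (gmult_lead gam alph)
  (Q := fun z z' => P z z' - quantum_bivector U z z')) => {}z {}z' => [|s].
  rewrite linearB /= Pmul quantum_multiplicative -bivectorB.
  apply: eq_bigr => s _; apply: eq_bigr => t _; congr (_ * _).
  by case: s t => [a|a] [b|b] /=; rewrite ?linearB ?subrr.
rewrite fpsDE fpsNE; apply/eqP; rewrite subr_eq0; apply/eqP.
apply: (gdiff_inj hsc); by rewrite (gdiff_quantum_bivector hsc); exact: hlin.
Qed.
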